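(* Let $\alpha_1>0$, $\beta_1<0$, $\alpha_2>0$, $\beta_2>0$. Then the spectrum of the boundary value problem $$(p(x)f')'-(q(x)-\lambda r(x))f=0\quad (0<x<L),\qquad f'(0)=(\alpha_1\lambda+\alpha_2)f(0),\qquad f'(L)=(\beta_1\lambda-\beta_2)f(L)$$ consists of an unbounded sequence of real eigenvalues $$\lambda_{-1}<\lambda_{-0}<0<\lambda_0<\lambda_1<\lambda_2<\dots\nearrow\infty,$$ and the corresponding eigenfunction $f(x;\lambda_l)$ has exactly $|l|$ zeros in $]0,L[$.
   Context: Here $L>0$ and $p,q,r$ are positive and sufficiently regular real functions on $[0,L]$ (regular enough that solutions are classical and the classical results on regularity of solutions of second order linear ODEs with respect to parameters, such as Peano's theorem, apply). $\alpha_1,\alpha_2,\beta_1,\beta_2$ are real constants. $\lambda\in\mathbb{C}$ is the spectral parameter; $\lambda$ is an eigenvalue if the problem has a nontrivial solution $f$ (an eigenfunction), and the spectrum is the set of eigenvalues. The indices are formal labels: $l\in\{-1,-0,0,1,2,\dots\}$, where $-0$ and $0$ are distinct labels with $|-0|=|0|=0$ and $|-1|=1$. $]a,b[$ denotes an open interval. *)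

(* Defs.v *)
From Stdlib Require Import Reals List.
From Coquelicot Require Import Coquelicot.
Open Scope R_scope.

Definition interval_cc (a b x : R) : Prop := a <= x <= b.
Definition interval_oo (a b x : R) : Prop := a < x < b.

(* [is_derive] with the neighbourhoods of x replaced by their traces on D.
   For D = [a,b] with a < b this is the one-sided derivative at the ends.
   The values of f outside D are irrelevant. *)
Definition is_derive_within {V : NormedModule R_AbsRing}
    (D : R -> Prop) (f : R -> V) (x : R) (l : V) : Prop :=
  filterdiff f (within D (locally x)) (fun y : R => scal y l).

Definition C1_on {V : NormedModule R_AbsRing}
    (D : R -> Prop) (f f' : R -> V) : Prop :=
  (forall x, D x -> is_derive_within D f x (f' x)) /\ continuous_on D f'.

(* The values of a complex function are differentiated over the real line. *)
Definition C1_on_C (D : R -> Prop) (f f' : R -> C) : Prop :=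
  C1_on (V := C_R_NormedModule) D f f'.

Definition is_derive_C (f : R -> C) (x : R) (l : C) : Prop :=
  is_derive (K := R_AbsRing) (V := C_R_NormedModule) f x l.

(* Minimal regularity for which the solutions are classical, i.e. twice
   continuously differentiable on [0,L]. *)
Definition regular_coefficients (L : R) (p q r : R -> R) : Prop :=
  (exists p' : R -> R, C1_on (V := R_NormedModule) (interval_cc 0 L) p p') /\
  continuous_on (interval_cc 0 L) q /\
  continuous_on (interval_cc 0 L) r.

Definition positive_on (D : R -> Prop) (g : R -> R) : Prop :=
  forall x, D x -> 0 < g x.

(* Here f' and pf'' are the derivatives of f and of p f'. Since p is C^1 and
   positive, f is twice differentiable in ]0,L[, and the equation makes f''
   extend continuously to [0,L]. *)
Definition is_solution (L : R) (p q r : R -> R) (alpha1 alpha2 beta1 beta2 : R)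
    (lambda : C) (f : R -> C) : Prop :=
  exists f' pf'' : R -> C,
    C1_on_C (interval_cc 0 L) f f' /\
    (forall x, interval_oo 0 L x ->
       is_derive_C (fun t => p t * f' t)%C x (pf'' x)) /\
    (forall x, interval_oo 0 L x ->
       (pf'' x - (q x - lambda * r x) * f x = 0)%C) /\
    (f' 0 = (alpha1 * lambda + alpha2) * f 0)%C /\
    (f' L = (beta1 * lambda - beta2) * f L)%C.

Definition is_eigenfunction (L : R) (p q r : R -> R)
    (alpha1 alpha2 beta1 beta2 : R) (lambda : C) (f : R -> C) : Prop :=
  is_solution L p q r alpha1 alpha2 beta1 beta2 lambda f /\
  exists x, interval_cc 0 L x /\ f x <> RtoC 0.

Definition is_eigenvalue (L : R) (p q r : R -> R)
    (alpha1 alpha2 beta1 beta2 : R) (lambda : C) : Prop :=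
  exists f, is_eigenfunction L p q r alpha1 alpha2 beta1 beta2 lambda f.

(* The labels -1, -0 and 0, 1, 2, ... *)
Inductive label : Set :=
| lbl_m1 : label
| lbl_m0 : label
| lbl : nat -> label.

Definition label_abs (l : label) : nat :=
  match l with
  | lbl_m1 => 1
  | lbl_m0 => 0
  | lbl n => n
  end.

Definition has_exactly_zeros (D : R -> Prop) (f : R -> C) (n : nat) : Prop :=
  exists zs : list R,
    NoDup zs /\ length zs = n /\
    forall x, In x zs <-> D x /\ f x = RtoC 0.

(* Main.v *)
Require Import Defs.
From Stdlib Require Import Reals Lra Lia List Arith FinFun ClassicalEpsilon.
From Coquelicot Require Import Coquelicot.
Open Scope R_scope.

(** The problem is rewritten as the system u' = P v, v' = (Q - l W) u with
    P = 1/p, Q = q, W = r and v = p f'. In polar coordinates u = rho sin phi,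
    v = rho cos phi, the angle satisfies a scalar equation of its own,
    phi' = P cos^2 phi + (l W - Q) sin^2 phi. For real l, let [phase l] be
    the angle that starts in ]0,PI[ where the condition at 0 says, let
    [target l] be the angle in ]0,PI[ that the condition at L asks for, and
    let [gap l] be [phase l L - target l]. Then l is an eigenvalue if and only
    if [gap l] is an integer multiple of PI. Since P > 0, the angle passes
    the multiples of PI, that is, the zeros of u, only upwards, so [gap l = n PI]
    means exactly n zeros in ]0,L[ (phase_zeros).

    It remains to see how often [gap] takes each of the values n PI. An
    eigenfunction f satisfies A(f,f) = l B(f,f) with the two quadratic forms

    - A(f,f) = int (p |f'|^2 + q |f|^2) + p(0) alpha2 |f(0)|^2 + p(L) beta2 |f(L)|^2,
    - B(f,f) = int r |f|^2 - p(0) alpha1 |f(0)|^2 + p(L) beta1 |f(L)|^2.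

    The form A is positive definite, and B is indefinite. At an eigenvalue the
    derivative of [gap] has the sign of B(f,f), hence that of l: [gap] crosses
    each level n PI only upwards on l > 0, and only downwards on l < 0
    (gap_crossing). So on either side of 0 it takes each such value at most
    once, and the values that it does take are found by bounding it:

    - [gap] is above -PI everywhere, and [gap 0] lies in ]-PI,0[;
    - [gap] is unbounded on l > 0 (gap_unbounded), so there it takes each of
      0, PI, 2 PI, ... once: these are the eigenvalues with labels 0, 1, 2, ...;
    - [gap] stays below 2 PI on l < 0, and is at least PI somewhere there
      (gap_neg_reaches_PI), so there it takes 0 and PI once each, the latter
      further from 0: these are the eigenvalues with labels -0 and -1.

    The same two forms show that all eigenvalues are real: B(f,f) is real, and
    A(f,f) > 0 (complex_system_trivial). Finally, uniqueness for the system
    makes every eigenfunction for a real eigenvalue a complex multiple of the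
    real solution u (system_proportional). *)

(** * Zeros, upward crossings and differential inequalities *)
Lemma continuous_pos_near (f : R -> R) (x : R) :
  continuous f x -> 0 < f x ->
  exists e, 0 < e /\ forall y, Rabs (y - x) < e -> 0 < f y.
Proof.
  intros Hc Hp.
  destruct (Hc (fun z => 0 < z) (open_gt 0 (f x) Hp)) as [e He].
  exists e. split. apply cond_pos. intros y Hy. apply He. exact Hy.
Qed.

Lemma first_zero (f : R -> R) (a b : R) :
  a <= b -> (forall x, a <= x <= b -> continuous f x) ->
  0 < f a -> f b <= 0 ->
  exists c, a < c <= b /\ f c = 0 /\ forall x, a <= x < c -> 0 < f x.
Proof.
  intros Hab Hc Ha Hb.
  set (E := fun x => a <= x <= b /\ forall t, a <= t <= x -> 0 < f t).
  destruct (completeness E) as [c [Hub Hlub]].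
  { exists b. intros x [Hx _]. lra. }
  { exists a. split. lra. intros t Ht. replace t with a by lra. exact Ha. }
  assert (Hac : a <= c).
  { apply Hub. split. lra. intros t Ht. replace t with a by lra. exact Ha. }
  assert (Hcb : c <= b).
  { apply Hlub. intros x [Hx _]. lra. }
  assert (Hpos : forall x, a <= x < c -> 0 < f x).
  { intros x Hx. destruct (Rlt_dec 0 (f x)) as [h|h]; [exact h|exfalso].
    assert (c <= x); [|lra].
    apply Hlub. intros y [Hy1 Hy2]. apply Rnot_lt_le. intros Hxy.
    apply h, Hy2. lra. }
  assert (Hle : f c <= 0).
  { apply Rnot_lt_le. intros Hp.
    destruct (continuous_pos_near f c (Hc c ltac:(lra)) Hp) as [e [He Hn]].
    assert (c < b) by (destruct (Req_dec c b) as [->|]; lra).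
    set (d := Rmin (e / 2) (b - c)).
    assert (0 < d <= e / 2 /\ d <= b - c).
    { unfold d. repeat split; [apply Rmin_case; lra | apply Rmin_l | apply Rmin_r]. }
    assert (c + d <= c); [|lra].
    apply Hub. split. lra. intros t Ht.
    destruct (Rlt_dec t c); [apply Hpos; lra|].
    apply Hn. rewrite Rabs_pos_eq; lra. }
  assert (Hge : 0 <= f c).
  { apply Rnot_lt_le. intros Hp.
    destruct (continuous_pos_near (fun x => - f x) c) as [e [He Hn]].
    { apply (continuous_opp f c), Hc. lra. }
    { lra. }
    assert (a < c) by (destruct (Req_dec a c) as [->|]; lra).
    set (d := Rmin (e / 2) (c - a)).
    assert (0 < d <= e / 2 /\ d <= c - a).
    { unfold d. repeat split; [apply Rmin_case; lra | apply Rmin_l | apply Rmin_r]. }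
    assert (0 < f (c - d)) by (apply Hpos; lra).
    assert (0 < - f (c - d)); [|lra].
    apply Hn. rewrite Rabs_left; lra. }
  exists c. split; [|split].
  - split; [|exact Hcb]. destruct (Req_dec a c) as [->|]; lra.
  - lra.
  - exact Hpos.
Qed.

Lemma last_zero (f : R -> R) (a b : R) :
  a <= b -> (forall x, a <= x <= b -> continuous f x) ->
  f a <= 0 -> 0 < f b ->
  exists c, a <= c < b /\ f c = 0 /\ forall x, c < x <= b -> 0 < f x.
Proof.
  intros Hab Hc Ha Hb.
  destruct (first_zero (fun x => f (- x)) (- b) (- a)) as [c [H1 [H2 H3]]].
  - lra.
  - intros x Hx. apply (continuous_comp (fun y => - y) f).
    apply (continuous_opp (fun y => y) x), continuous_id.
    apply Hc. lra.
  - rewrite Ropp_involutive. exact Hb.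
  - rewrite Ropp_involutive. exact Ha.
  - exists (- c). split; [lra|split].
    + exact H2.
    + intros x Hx. rewrite <- (Ropp_involutive x). apply H3. lra.
Qed.

(** Strict crossing in a punctured neighbourhood; no derivative is required,
    because [gap] will be handled without differentiating it. *)
Definition crosses_up (f : R -> R) (l c : R) : Prop :=
  exists e, 0 < e /\ forall y,
    (c < y < c + e -> l < f y) /\ (c - e < y < c -> f y < l).

(** A continuous function that crosses the level [l] only upwards cannot come
    back to it: at the first return it would arrive from above. *)
Lemma crosses_up_above (f : R -> R) (l a b : R) :
  (forall x, a <= x <= b -> continuous f x) ->
  (forall c, a <= c <= b -> f c = l -> crosses_up f l c) ->
  a < b -> l <= f a -> l < f b.
Proof.
  intros Hc Hup Hab Ha. apply Rnot_le_lt. intros Hb.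
  assert (exists a', a <= a' < b /\ l < f a') as [a' [Ha' Hl]].
  { destruct (Req_dec (f a) l) as [E|E]; [|exists a; lra].
    destruct (Hup a ltac:(lra) E) as [e [He Hn]].
    exists (a + Rmin (e / 2) ((b - a) / 2)).
    assert (0 < Rmin (e / 2) ((b - a) / 2)) by (apply Rmin_case; lra).
    assert (H1 := Rmin_l (e / 2) ((b - a) / 2)).
    assert (H2 := Rmin_r (e / 2) ((b - a) / 2)).
    split; [lra|]. apply Hn. lra. }
  destruct (first_zero (fun x => f x - l) a' b) as [c [H1 [H2 H3]]]; try lra.
  { intros x Hx. apply (continuous_minus f (fun _ => l)).
    apply Hc; lra. apply continuous_const. }
  destruct (Hup c) as [e [He Hn]]; try lra.
  set (d := Rmin (e / 2) (c - a')).
  assert (0 < d <= e / 2 /\ d <= c - a').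
  { unfold d. repeat split; [apply Rmin_case; lra | apply Rmin_l | apply Rmin_r]. }
  assert (f (c - d) < l) by (apply Hn; lra).
  assert (0 < f (c - d) - l) by (apply H3; lra). lra.
Qed.

Lemma crosses_up_derive (f : R -> R) (c d : R) :
  is_derive f c d -> 0 < d -> crosses_up f (f c) c.
Proof.
  intros Hd Hp.
  apply is_derive_Reals in Hd.
  destruct (Hd d Hp) as [e He].
  exists e. split; [apply cond_pos|]. intros y.
  assert (K : forall h, h <> 0 -> Rabs h < e -> 0 < (f (c + h) - f c) / h).
  { intros h H1 H2. assert (H := He h H1 H2). apply Rabs_def2 in H. lra. }
  split; intros Hy.
  - assert (H := K (y - c) ltac:(lra)).
    replace (c + (y - c)) with y in H by ring.
    rewrite Rabs_pos_eq in H by lra. specialize (H ltac:(lra)).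
    assert (0 < (f y - f c) / (y - c) * (y - c)) by (apply Rmult_lt_0_compat; lra).
    field_simplify in H0; lra.
  - assert (H := K (y - c) ltac:(lra)).
    replace (c + (y - c)) with y in H by ring.
    rewrite Rabs_left in H by lra. specialize (H ltac:(lra)).
    assert (0 < (f y - f c) / (y - c) * (c - y)) by (apply Rmult_lt_0_compat; lra).
    replace ((f y - f c) / (y - c) * (c - y)) with (f c - f y) in H0 by (field; lra). lra.
Qed.

(** The derivative is needed only in the open interval: the flux of an
    eigenfunction is known to be differentiable only there. *)
Lemma le_of_derive_nonneg (f df : R -> R) (a b : R) :
  a <= b -> (forall x, a <= x <= b -> continuous f x) ->
  (forall x, a < x < b -> is_derive f x (df x)) ->
  (forall x, a < x < b -> 0 <= df x) -> f a <= f b.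
Proof.
  intros Hab Hc Hd Hp.
  destruct (Req_dec a b) as [->|Hne]; [lra|].
  (* The mean value point may be an end point, where df has no meaning:
     there the derivative is replaced by 0. *)
  destruct (MVT_gen f a b (fun x => if Rlt_dec a x then if Rlt_dec x b then df x else 0 else 0))
    as [c [H1 H2]].
  - rewrite Rmin_left, Rmax_right by lra. intros x Hx.
    destruct (Rlt_dec a x); [|lra]. destruct (Rlt_dec x b); [|lra]. now apply Hd.
  - rewrite Rmin_left, Rmax_right by lra. intros x Hx.
    apply continuity_pt_filterlim, Hc, Hx.
  - rewrite Rmin_left, Rmax_right in H1 by lra.
    destruct (Rlt_dec a c); [destruct (Rlt_dec c b)|]; try nra.
    assert (0 <= df c) by (apply Hp; lra). nra.
Qed.

(** Gronwall's inequality in the form of a barrier: after the last zero of [d]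
    the function exp(-K x) d x does not increase. The inequality is asked for
    only where [d] is positive, so [d] can be a difference of two solutions
    with no absolute value taken. *)
Lemma gronwall_nonpos (d d' : R -> R) (a b K : R) :
  a <= b -> (forall x, a <= x <= b -> continuous d x) ->
  (forall x, a < x < b -> is_derive d x (d' x)) ->
  (forall x, a < x < b -> 0 < d x -> d' x <= K * d x) ->
  d a <= 0 -> d b <= 0.
Proof.
  intros Hab Hc Hd Hle Ha. apply Rnot_lt_le. intros Hb.
  destruct (last_zero d a b Hab Hc Ha Hb) as [c [H1 [H2 H3]]].
  assert (H : - (exp (- K * c) * d c) <= - (exp (- K * b) * d b)).
  { apply (le_of_derive_nonneg (fun x => - (exp (- K * x) * d x))
      (fun x => - (exp (- K * x) * (d' x - K * d x)))); [lra| | |].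
    - intros x Hx.
      apply (continuous_opp (fun x => exp (- K * x) * d x)).
      apply (continuous_mult (fun x => exp (- K * x)) d).
      + apply (ex_derive_continuous (fun x => exp (- K * x))). auto_derive. exact I.
      + apply Hc. lra.
    - intros x Hx. assert (Hdx := Hd x ltac:(lra)).
      auto_derive. repeat split. exists (d' x). exact Hdx.
      rewrite (is_derive_unique _ _ _ Hdx : Derive (fun x : R => d x) x = d' x). ring.
    - intros x Hx. assert (0 < d x) by (apply H3; lra).
      assert (H4 := Hle x ltac:(lra) H). assert (H5 := exp_pos (- K * x)). nra. }
  rewrite H2 in H. assert (H5 := exp_pos (- K * b)). nra.
Qed.

(** * Global solutions of scalar Lipschitz equations *)
Lemma derive_RInt_continuous (h : R -> R) (x : R) :
  (forall t, continuous h t) -> is_derive (fun y => RInt h 0 y) x (h x).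
Proof.
  intros Hh. apply (is_derive_RInt h (fun y => RInt h 0 y) 0 x); [|apply Hh].
  exists (mkposreal 1 Rlt_0_1). intros y _. apply (@RInt_correct R_CompleteNormedModule).
  apply (@ex_RInt_continuous R_CompleteNormedModule). intros; apply Hh.
Qed.

Section Picard.

Context (F : R -> R -> R) (K B y0 : R).
Context (K_pos : 0 < K).
Context (F_cont : forall y : R -> R, (forall x, continuous y x) ->
  forall x, continuous (fun t => F t (y t)) x).
Context (F_lip : forall t y z, Rabs (F t y - F t z) <= K * Rabs (y - z)).
Context (F_bnd : forall t, Rabs (F t y0) <= B).

Fixpoint picard_iter (n : nat) : R -> R :=
  match n with
  | O => fun _ => y0
  | S n => fun x => y0 + RInt (fun t => F t (picard_iter n t)) 0 x
  end.

(** Integrating exp(2 K |x|) from 0 gains a factor 1 / (2 K), so in the norm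
    weighted by it a Picard step, with Lipschitz constant K, contracts by 1/2.
    The smooth weight is comparable to this one and has the same effect. *)
Definition picard_weight (x : R) : R := exp (2 * K * x) + exp (- (2 * K * x)).

Lemma picard_weight_ge1 x : 1 <= picard_weight x.
Proof.
  unfold picard_weight.
  destruct (Rle_dec 0 x).
  - assert (H := exp_ineq1_le (2 * K * x)). assert (H' := exp_pos (- (2 * K * x))). nra.
  - assert (H := exp_ineq1_le (- (2 * K * x))). assert (H' := exp_pos (2 * K * x)). nra.
Qed.

Lemma picard_weight_continuous x : continuous picard_weight x.
Proof.
  apply (ex_derive_continuous picard_weight). unfold picard_weight. auto_derive. exact I.
Qed.

Lemma RInt_picard_weight (h : R -> R) (C x : R) :
  (forall t, continuous h t) ->
  (forall t, Rabs (h t) <= C * picard_weight t) ->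
  Rabs (RInt h 0 x) <= C / (2 * K) * picard_weight x.
Proof.
  intros Hh Hb.
  set (S := fun t => C / (2 * K) * (exp (2 * K * t) - exp (- (2 * K * t)))).
  assert (HC : 0 <= C).
  { assert (H := Hb 0). assert (H' := Rabs_pos (h 0)).
    assert (H1 := picard_weight_ge1 0). nra. }
  assert (HC' : 0 <= C / (2 * K)).
  { apply Rmult_le_pos; [lra|]. apply Rlt_le, Rinv_0_lt_compat. lra. }
  assert (HS : forall a b, is_RInt (fun t => C * picard_weight t) a b (S b - S a)).
  { intros a b. apply (is_RInt_derive S (fun t => C * picard_weight t)).
    - intros t _. unfold S, picard_weight. auto_derive; [exact I|]. field. lra.
    - intros t _. apply (continuous_scal_r C picard_weight), picard_weight_continuous. }
  assert (Hex : forall a b, is_RInt h a b (RInt h a b)).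
  { intros a b. apply (@RInt_correct R_CompleteNormedModule).
    apply (@ex_RInt_continuous R_CompleteNormedModule). intros; apply Hh. }
  assert (HS0 : S 0 = 0) by (unfold S; rewrite Rmult_0_r, Ropp_0; ring).
  assert (HSx : Rabs (S x) <= C / (2 * K) * picard_weight x).
  { unfold S, picard_weight. rewrite Rabs_mult, (Rabs_pos_eq (C / (2 * K))) by exact HC'.
    apply Rmult_le_compat_l; [exact HC'|].
    assert (H1 := exp_pos (2 * K * x)). assert (H2 := exp_pos (- (2 * K * x))).
    apply Rabs_le. lra. }
  refine (Rle_trans _ _ _ _ HSx).
  destruct (Rle_dec 0 x) as [h0|h0].
  - assert (H := norm_RInt_le h (fun t => C * picard_weight t) 0 x _ _ h0
      (fun t _ => Hb t) (Hex 0 x) (HS 0 x)).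
    refine (Rle_trans _ _ _ H _). rewrite HS0, Rminus_0_r. apply Rle_abs.
  - assert (H := norm_RInt_le h (fun t => C * picard_weight t) x 0 _ _ ltac:(lra)
      (fun t _ => Hb t) (Hex x 0) (HS x 0)).
    replace (RInt h 0 x) with (- RInt h x 0).
    2: apply (opp_RInt_swap h x 0); eexists; apply Hex.
    rewrite Rabs_Ropp. refine (Rle_trans _ _ _ H _). rewrite HS0, <- Rabs_Ropp.
    rewrite Rminus_0_l. apply Rle_abs.
Qed.

Lemma picard_iter_continuous n x : continuous (picard_iter n) x.
Proof.
  revert x. induction n as [|n IH]; intros x.
  - apply continuous_const.
  - apply (continuous_plus (fun _ => y0)
      (fun x => RInt (fun t => F t (picard_iter n t)) 0 x)).
    apply continuous_const.
    apply (ex_derive_continuous (fun x => RInt (fun t => F t (picard_iter n t)) 0 x)).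
    eexists. apply (derive_RInt_continuous (fun t => F t (picard_iter n t))).
    apply F_cont, IH.
Qed.

Lemma RInt_picard_diff (y z : R -> R) (C x : R) :
  (forall t, continuous y t) -> (forall t, continuous z t) ->
  (forall t, Rabs (y t - z t) <= C * picard_weight t) ->
  Rabs (RInt (fun t => F t (y t)) 0 x - RInt (fun t => F t (z t)) 0 x)
    <= C / 2 * picard_weight x.
Proof.
  intros Hy Hz Hd.
  assert (E : RInt (fun t => F t (y t)) 0 x - RInt (fun t => F t (z t)) 0 x
    = RInt (fun t => F t (y t) - F t (z t)) 0 x).
  { symmetry. apply (RInt_minus (fun t => F t (y t)) (fun t => F t (z t)));
    apply (@ex_RInt_continuous R_CompleteNormedModule); intros; now apply F_cont. }
  rewrite E. replace (C / 2) with (K * C / (2 * K)) by (field; lra).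
  apply (RInt_picard_weight (fun t => F t (y t) - F t (z t))).
  - intros t. apply (continuous_minus (fun t => F t (y t)) (fun t => F t (z t)));
    now apply F_cont.
  - intros t. refine (Rle_trans _ _ _ (F_lip _ _ _) _).
    rewrite Rmult_assoc. apply Rmult_le_compat_l; [lra|apply Hd].
Qed.

Lemma picard_step n x :
  Rabs (picard_iter (S n) x - picard_iter n x)
    <= B / (2 * K) * (/ 2) ^ n * picard_weight x.
Proof.
  revert x. induction n as [|n IH]; intros x.
  - simpl. rewrite Rplus_minus_l.
    rewrite Rmult_1_r. apply (RInt_picard_weight (fun t => F t y0)).
    + apply (F_cont (fun _ => y0)). intros. apply continuous_const.
    + intros t. refine (Rle_trans _ _ _ (F_bnd t) _).
      assert (H := picard_weight_ge1 t). assert (H' := F_bnd t).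
      assert (H1 := Rabs_pos (F t y0)). nra.
  - replace (picard_iter (S (S n)) x - picard_iter (S n) x) with
      (RInt (fun t => F t (picard_iter (S n) t)) 0 x -
       RInt (fun t => F t (picard_iter n t)) 0 x) by exact (eq_sym (Rminus_plus_l_l _ _ _)).
    replace (B / (2 * K) * (/ 2) ^ S n) with (B / (2 * K) * (/ 2) ^ n / 2)
      by (simpl; field; lra).
    apply RInt_picard_diff; [apply picard_iter_continuous..|]. exact IH.
Qed.

(** The bounds of picard_step summed from [n] on: a geometric series with
    ratio 1/2. *)
Definition picard_err (n : nat) : R := B / K * (/ 2) ^ n.

Lemma picard_cauchy n k x :
  Rabs (picard_iter (n + k) x - picard_iter n x) <= picard_err n * picard_weight x.
Proof.
  assert (H : Rabs (picard_iter (n + k) x - picard_iter n x)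
    <= B / K * ((/ 2) ^ n - (/ 2) ^ (n + k)) * picard_weight x).
  { induction k as [|k IH].
    - rewrite Nat.add_0_r, !Rminus_diag, Rabs_R0. lra.
    - rewrite Nat.add_succ_r.
      replace (picard_iter (S (n + k)) x - picard_iter n x) with
        ((picard_iter (S (n + k)) x - picard_iter (n + k) x) +
         (picard_iter (n + k) x - picard_iter n x)) by ring.
      refine (Rle_trans _ _ _ (Rabs_triang _ _) _).
      assert (H := picard_step (n + k) x).
      replace (B / K * ((/ 2) ^ n - (/ 2) ^ S (n + k)) * picard_weight x) with
        (B / (2 * K) * (/ 2) ^ (n + k) * picard_weight x +
         B / K * ((/ 2) ^ n - (/ 2) ^ (n + k)) * picard_weight x)
        by (simpl; field; lra).
      lra. }
  refine (Rle_trans _ _ _ H _). unfold picard_err.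
  apply Rmult_le_compat_r. { assert (H1 := picard_weight_ge1 x). lra. }
  assert (0 <= B / K).
  { apply Rmult_le_pos. assert (H1 := F_bnd 0). assert (H2 := Rabs_pos (F 0 y0)). lra.
    apply Rlt_le, Rinv_0_lt_compat, K_pos. }
  apply Rmult_le_compat_l; [exact H0|].
  assert (0 < (/ 2) ^ (n + k)) by (apply pow_lt; lra). lra.
Qed.

Lemma picard_err_lim : is_lim_seq picard_err 0.
Proof.
  unfold picard_err. replace (Finite 0) with (Rbar_mult (B / K) 0) by (simpl; f_equal; ring).
  apply is_lim_seq_scal_l, is_lim_seq_geom. rewrite Rabs_pos_eq; lra.
Qed.

Lemma picard_small (e x : R) : 0 < e ->
  exists N, forall n, (N <= n)%nat -> picard_err n * picard_weight x < e.
Proof.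
  intros He.
  assert (Hw := picard_weight_ge1 x).
  assert (Hp : 0 < e / picard_weight x) by (apply Rdiv_lt_0_compat; lra).
  destruct (proj1 (is_lim_seq_Reals _ _) picard_err_lim _ Hp) as [N HN].
  exists N. intros n Hn. assert (H := HN n Hn). unfold Rdist in H.
  rewrite Rminus_0_r in H. assert (H' := Rle_abs (picard_err n)).
  apply (Rmult_lt_reg_r (/ picard_weight x)).
  apply Rinv_0_lt_compat; lra.
  rewrite Rmult_assoc, Rinv_r by lra. unfold Rdiv in H. lra.
Qed.

Definition picard_lim (x : R) : R := real (Lim_seq (fun n => picard_iter n x)).

Lemma picard_lim_correct x : is_lim_seq (fun n => picard_iter n x) (picard_lim x).
Proof.
  apply (Lim_seq_correct' (fun n => picard_iter n x)), ex_lim_seq_cauchy_corr.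
  intros e. destruct (picard_small (e / 2) x) as [N HN].
  { destruct e; simpl; lra. }
  exists N. intros n m Hn Hm.
  assert (H1 := picard_cauchy N (n - N) x). assert (H2 := picard_cauchy N (m - N) x).
  replace (N + (n - N))%nat with n in H1 by lia.
  replace (N + (m - N))%nat with m in H2 by lia.
  assert (H3 := HN N (le_n N)).
  apply Rabs_le_between in H1, H2. apply Rabs_def1; lra.
Qed.

Lemma picard_lim_near n x :
  Rabs (picard_lim x - picard_iter n x) <= picard_err n * picard_weight x.
Proof.
  assert (H : is_lim_seq (fun k => Rabs (picard_iter (n + k) x - picard_iter n x))
    (Rabs (picard_lim x - picard_iter n x))).
  { apply (is_lim_seq_abs _ (picard_lim x - picard_iter n x)).
    apply (is_lim_seq_minus' (fun k => picard_iter (n + k) x) (fun _ => picard_iter n x)).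
    - apply (is_lim_seq_ext (fun k => picard_iter (k + n) x)).
      intros k; now rewrite Nat.add_comm.
      apply (is_lim_seq_incr_n (fun k => picard_iter k x)), picard_lim_correct.
    - apply is_lim_seq_const. }
  apply (is_lim_seq_le _ _ _ _ (fun k => picard_cauchy n k x) H (is_lim_seq_const _)).
Qed.

Lemma picard_lim_continuous x : continuous picard_lim x.
Proof.
  apply filterlim_locally. intros e.
  destruct (picard_small (e / 4) x) as [N HN]. { destruct e; simpl; lra. }
  specialize (HN N (le_n N)).
  assert (Hw : 0 < e / 4 - picard_err N * picard_weight x) by lra.
  assert (C1 : locally x (fun y => picard_err N * picard_weight y < e / 4)).
  { assert (C := continuous_scal_r (picard_err N) picard_weight x
      (picard_weight_continuous x)).
    apply (C (fun z => z < e / 4)). apply open_lt. exact HN. }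
  assert (C2 := proj1 (filterlim_locally _ _) (picard_iter_continuous N x)
    (pos_div_2 e)).
  generalize (filter_and _ _ C1 C2). apply filter_imp. intros y [H1 H2].
  assert (H3 := picard_lim_near N x). assert (H4 := picard_lim_near N y).
  unfold ball in *. simpl in *. unfold AbsRing_ball, abs, minus, plus, opp in *. simpl in *.
  apply Rabs_def2 in H2. apply Rabs_le_between in H3, H4. apply Rabs_def1; lra.
Qed.

Lemma picard_lim_integral x :
  picard_lim x = y0 + RInt (fun t => F t (picard_lim t)) 0 x.
Proof.
  assert (H1 : is_lim_seq (fun n => picard_iter (S n) x) (picard_lim x)).
  { apply (is_lim_seq_incr_1 (fun n => picard_iter n x)), picard_lim_correct. }
  assert (H2 : is_lim_seq (fun n => picard_iter (S n) x)
    (y0 + RInt (fun t => F t (picard_lim t)) 0 x)).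
  { apply is_lim_seq_Reals. intros e He.
    destruct (picard_small e x He) as [N HN]. exists N. intros n Hn.
    assert (H := HN n Hn).
    assert (H3 := RInt_picard_diff (picard_iter n) picard_lim (picard_err n) x
      (picard_iter_continuous n) picard_lim_continuous).
    assert (H0 : 0 <= picard_err n * picard_weight x)
      by (refine (Rle_trans _ _ _ (Rabs_pos _) (picard_lim_near n x))).
    unfold Rdist. simpl picard_iter.
    rewrite Rminus_plus_l_l.
    refine (Rle_lt_trans _ _ _ (H3 _) _); [|lra].
    intros t. rewrite Rabs_minus_sym. apply picard_lim_near. }
  apply is_lim_seq_unique in H1, H2. rewrite H1 in H2. now injection H2.
Qed.

(** The contraction holds on the whole line at once, so the solution is
    global; in particular it is differentiable on both sides at the ends of
    the interval of interest. *)
Theorem cauchy_lipschitz :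
  exists y : R -> R, y 0 = y0 /\ forall x, is_derive y x (F x (y x)).
Proof.
  exists picard_lim. split.
  - rewrite picard_lim_integral, RInt_point. apply Rplus_0_r.
  - intros x. apply (is_derive_ext (fun x => y0 + RInt (fun t => F t (picard_lim t)) 0 x)).
    { intros t. symmetry. apply picard_lim_integral. }
    rewrite <- (Rplus_0_l (F x (picard_lim x))).
    apply (is_derive_plus (fun _ => y0) (fun x => RInt (fun t => F t (picard_lim t)) 0 x)).
    apply (is_derive_const y0).
    apply (derive_RInt_continuous (fun t => F t (picard_lim t))).
    apply F_cont, picard_lim_continuous.
Qed.

End Picard.

(** * One-sided derivatives, complex values and clamping *)
Lemma is_derive_within_of_derive {V : NormedModule R_AbsRing}
    (D : R -> Prop) (f : R -> V) (x : R) (l : V) :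
  D x -> is_derive f x l -> is_derive_within D f x l.
Proof.
  intros HD [Hl Hf]. split; [exact Hl|].
  intros z Hz e.
  (* As x lies in D, the neighbourhood filter restricted to D converges to x only. *)
  assert (E : z = x).
  { apply Req_le_aux. intros eps.
    assert (H := Hz (ball z eps) (locally_ball z eps)).
    apply locally_singleton in H. specialize (H HD).
    change (Rabs (x - z) < eps) in H. rewrite Rabs_minus_sym. lra. }
  subst z. assert (H := Hf x (fun P HP => HP) e).
  apply (filter_le_within D), H.
Qed.

Lemma is_derive_of_within {V : NormedModule R_AbsRing}
    (D : R -> Prop) (f : R -> V) (x : R) (l : V) :
  locally x D -> is_derive_within D f x l -> is_derive f x l.
Proof.
  intros HD [Hl Hf]. split; [exact Hl|].
  intros z Hz e.
  assert (H : is_filter_lim (within D (locally x)) z).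
  { intros P HP. apply (filter_le_within D), Hz, HP. }
  generalize (filter_and _ _ HD (Hf z H e)). apply filter_imp.
  intros y [H1 H2]. exact (H2 H1).
Qed.

Lemma continuous_on_of_derive_within {V : NormedModule R_AbsRing}
    (D : R -> Prop) (f f' : R -> V) :
  (forall x, D x -> is_derive_within D f x (f' x)) -> continuous_on D f.
Proof.
  intros H x Hx.
  apply (filterdiff_continuous_aux (F := within D (locally x)) f).
  - eexists. apply (H x Hx).
  - intros P HP. now apply (filter_le_within D).
Qed.

Lemma is_linear_RtoC : is_linear (U := R_NormedModule) (V := C_R_NormedModule) RtoC.
Proof.
  split.
  - intros x y. apply injective_projections; simpl; [reflexivity|].
    symmetry. apply Rplus_0_r.
  - intros k x. apply injective_projections; simpl; [reflexivity|].
    symmetry. apply Rmult_0_r.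
  - exists 1. split; [lra|]. intros x. rewrite Rmult_1_l.
    right. change (sqrt (Rabs x ^ 2 + Rabs 0 ^ 2) = Rabs x).
    rewrite Rabs_R0. replace (Rabs x ^ 2 + 0 ^ 2) with (Rabs x ^ 2) by ring.
    apply sqrt_pow2, Rabs_pos.
Qed.

Lemma is_derive_RtoC (f : R -> R) (x l : R) :
  is_derive f x l -> is_derive_C (fun t => RtoC (f t)) x (RtoC l).
Proof.
  intros H. unfold is_derive_C, is_derive.
  apply filterdiff_ext_lin with (l1 := fun y : R => RtoC (scal y l)).
  - apply (filterdiff_comp' (V := R_NormedModule) (W := C_R_NormedModule) f RtoC).
    exact H. apply filterdiff_linear, is_linear_RtoC.
  - intros y. apply (linear_scal _ is_linear_RtoC).
Qed.

Lemma is_derive_C_components (f : R -> C) (x : R) (l : C) :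
  is_derive_C f x l ->
  is_derive (fun t => fst (f t)) x (fst l) /\ is_derive (fun t => snd (f t)) x (snd l).
Proof.
  intros H. split.
  - apply (filterdiff_comp' (V := C_R_NormedModule) (W := R_NormedModule) f fst x
      (fun y : R => scal y l) fst).
    exact H. apply filterdiff_linear, (is_linear_fst (U := R_NormedModule) (V := R_NormedModule)).
  - apply (filterdiff_comp' (V := C_R_NormedModule) (W := R_NormedModule) f snd x
      (fun y : R => scal y l) snd).
    exact H. apply filterdiff_linear, (is_linear_snd (U := R_NormedModule) (V := R_NormedModule)).
Qed.

(** Composing with [clamp] turns functions that are continuous on [0,L] into
    functions that are continuous on the line, with the same bounds. *)
Definition clamp (L x : R) : R := Rmax 0 (Rmin L x).

Lemma clamp_in L x : 0 <= L -> interval_cc 0 L (clamp L x).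
Proof.
  intros HL. unfold clamp, interval_cc. split; [apply Rmax_l|].
  apply Rmax_lub; [exact HL|apply Rmin_l].
Qed.

Lemma clamp_id L x : 0 <= x <= L -> clamp L x = x.
Proof. intros H. unfold clamp. rewrite Rmin_right, Rmax_right; lra. Qed.

Lemma clamp_lipschitz L x y : Rabs (clamp L y - clamp L x) <= Rabs (y - x).
Proof.
  unfold clamp, Rmax, Rmin, Rabs.
  repeat (destruct Rle_dec || destruct Rcase_abs); lra.
Qed.

Lemma continuous_clamp {U : UniformSpace} L (f : R -> U) :
  0 <= L -> continuous_on (interval_cc 0 L) f ->
  forall x, continuous (fun t => f (clamp L t)) x.
Proof.
  intros HL Hf x P HP.
  destruct (Hf (clamp L x) (clamp_in L x HL) P HP) as [e He].
  exists e. intros y Hy. apply He; [|now apply clamp_in].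
  change (Rabs (clamp L y - clamp L x) < e).
  exact (Rle_lt_trans _ _ _ (clamp_lipschitz L x y) Hy).
Qed.

Lemma locally_between L x : 0 < x < L -> locally x (fun y => 0 < y < L).
Proof.
  intros Hx. exists (mkposreal (Rmin x (L - x)) ltac:(apply Rmin_case; lra)).
  intros y Hy. change (Rabs (y - x) < Rmin x (L - x)) in Hy. apply Rabs_def2 in Hy.
  assert (H1 := Rmin_l x (L - x)). assert (H2 := Rmin_r x (L - x)). lra.
Qed.

Lemma positive_bounds L (g : R -> R) :
  0 <= L -> continuous_on (interval_cc 0 L) g -> positive_on (interval_cc 0 L) g ->
  exists m M, 0 < m /\ forall x, m <= g (clamp L x) <= M.
Proof.
  intros HL Hc Hp. assert (C := continuous_clamp L g HL Hc).
  assert (C' : forall x, 0 <= x <= L -> continuity_pt (fun t => g (clamp L t)) x).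
  { intros x _. apply continuity_pt_filterlim, C. }
  destruct (continuity_ab_min _ 0 L HL C') as [a [Ha _]].
  destruct (continuity_ab_maj _ 0 L HL C') as [b [Hb _]].
  exists (g (clamp L a)), (g (clamp L b)). split; [apply Hp, clamp_in, HL|].
  intros x. assert (Hx := clamp_in L x HL).
  assert (H1 := Ha _ Hx). assert (H2 := Hb _ Hx). cbv beta in H1, H2.
  rewrite (clamp_id L (clamp L x) Hx) in H1, H2. lra.
Qed.

(** * The inverse cotangent and a reparametrized angle *)

(** The branch with values in ]0,PI[, continuous through 0. *)
Definition arccot (z : R) : R := PI / 2 - atan z.

Lemma arccot_bound z : 0 < arccot z < PI.
Proof. unfold arccot. assert (H := atan_bound z). lra. Qed.

Lemma sin_arccot_pos z : 0 < sin (arccot z).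
Proof. apply sin_gt_0; apply arccot_bound. Qed.

Lemma cos_arccot z : cos (arccot z) = z * sin (arccot z).
Proof.
  unfold arccot. rewrite cos_shift, sin_shift.
  assert (H := atan_bound z).
  assert (Hc : 0 < cos (atan z)) by (apply cos_gt_0; lra).
  rewrite <- (tan_atan z) at 2. unfold tan. field. lra.
Qed.

Lemma arccot_continuous z : continuous arccot z.
Proof.
  apply (continuous_minus (fun _ => PI / 2) atan). apply continuous_const.
  apply (ex_derive_continuous atan). eexists. apply is_derive_atan.
Qed.

Lemma exp_nondecreasing a b : a <= b -> exp a <= exp b.
Proof.
  intros [H | ->]; [left; now apply exp_increasing|right; reflexivity].
Qed.

Lemma sin_sqr_add_cos_sqr x : sin x * sin x + cos x * cos x = 1.
Proof. exact (sin2_cos2 x). Qed.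

Lemma sin_lipschitz a b : Rabs (sin a - sin b) <= Rabs (a - b).
Proof.
  destruct (MVT_gen sin b a cos) as [c [_ H]].
  - intros x _. apply is_derive_sin.
  - intros x _. apply continuity_sin.
  - rewrite H, Rabs_mult. assert (H1 := COS_bound c).
    assert (Rabs (cos c) <= 1) by (apply Rabs_le; lra).
    assert (H2 := Rabs_pos (a - b)). nra.
Qed.

Lemma cos_lipschitz a b : Rabs (cos a - cos b) <= Rabs (a - b).
Proof.
  rewrite !cos_sin. replace (a - b) with ((PI / 2 + a) - (PI / 2 + b)) by ring.
  apply sin_lipschitz.
Qed.

Lemma sin_IZR_PI k : sin (IZR k * PI) = 0.
Proof. apply sin_eq_0_1. eauto. Qed.

Lemma arccot_lt_PI2 z : 0 < z -> arccot z < PI / 2.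
Proof.
  intros Hz. unfold arccot. assert (H := atan_increasing 0 z Hz). rewrite atan_0 in H. lra.
Qed.

Lemma arccot_gt_PI2 z : z < 0 -> PI / 2 < arccot z.
Proof.
  intros Hz. unfold arccot. assert (H := atan_increasing z 0 Hz). rewrite atan_0 in H. lra.
Qed.

Lemma arccot_inv_pos z : 0 < z -> arccot z = atan (/ z).
Proof. intros Hz. unfold arccot. now rewrite atan_inv. Qed.

Lemma arccot_neg z : 0 < z -> arccot (- z) = PI + atan (- / z).
Proof.
  intros Hz. unfold arccot. rewrite !atan_opp, atan_inv by exact Hz. lra.
Qed.

(** This is cos^2 = 1 / (1 + tan^2), without a division. *)
Lemma cos_atan_sqr z : cos (atan z) * cos (atan z) * (1 + z * z) = 1.
Proof.
  assert (H := atan_bound z).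
  assert (Hc : 0 < cos (atan z)) by (apply cos_gt_0; lra).
  assert (Hs : sin (atan z) = z * cos (atan z)).
  { rewrite <- (tan_atan z) at 2. unfold tan. field. lra. }
  assert (H1 := sin_sqr_add_cos_sqr (atan z)). rewrite Hs in H1. lra.
Qed.

(** The continuous branch of the angle whose tangent is k tan t: for
    theta' = a cos^2 theta + b sin^2 theta and k = sqrt (b/a), the angle
    [unwrap k theta] grows at the constant rate sqrt (a b). It is written as a
    perturbation of [t] so that no branch has to be chosen. *)
Definition unwrap (k t : R) : R :=
  t + atan ((k - 1) * (sin t * cos t) / (cos t * cos t + k * (sin t * sin t))).

Lemma weighted_square_pos k t : 0 < k -> 0 < cos t * cos t + k * (sin t * sin t).
Proof.
  intros Hk. assert (H := sin_sqr_add_cos_sqr t).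
  assert (0 <= sin t * sin t) by apply Rle_0_sqr.
  assert (0 <= cos t * cos t) by apply Rle_0_sqr.
  destruct (Req_dec (sin t * sin t) 0) as [E|E]; nra.
Qed.

Lemma unwrap_derive k t : 0 < k ->
  is_derive (unwrap k) t (k / (cos t * cos t + k * k * (sin t * sin t))).
Proof.
  intros Hk. unfold unwrap.
  assert (HD := weighted_square_pos k t Hk).
  assert (HE := weighted_square_pos (k * k) t ltac:(nra)).
  assert (H := sin_sqr_add_cos_sqr t).
  assert (HN : (cos t * cos t + k * (sin t * sin t)) * (cos t * cos t + k * (sin t * sin t))
    + ((k - 1) * (sin t * cos t)) * ((k - 1) * (sin t * cos t))
    = cos t * cos t + k * k * (sin t * sin t)).
  { set (s := sin t) in *. set (c := cos t) in *.
    transitivity ((c * c + k * k * (s * s)) * (s * s + c * c)); [ring|rewrite H; ring]. }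
  auto_derive. { repeat split; lra. }
  set (s := sin t) in *. set (c := cos t) in *.
  set (D := c * c + k * (s * s)) in *.
  set (E := c * c + k * k * (s * s)) in *.
  set (N := (k - 1) * (s * c)) in *.
  assert (Hn : forall u, u = N * / D -> 1 + u * (u * 1) = E / (D * D)).
  { intros u ->. rewrite <- HN. field. lra. }
  assert (HK : E + (k - 1) * (c * c - k * (s * s)) = k).
  { transitivity (k * (s * s + c * c)); [unfold E; ring|rewrite H; ring]. }
  match goal with |- 1 + ?n * / ?q = _ =>
    replace q with (E / (D * D)) by (symmetry; apply Hn; reflexivity);
    replace n with ((k - 1) * (c * c - k * (s * s)) / (D * D)) end.
  - rewrite <- HK at 3. field. lra.
  - transitivity ((k - 1) * (c * c - k * (s * s)) * (s * s + c * c) / (D * D));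
      [rewrite H; field; lra|].
    unfold N, D. field. fold D. lra.
Qed.

Lemma unwrap_near k t : Rabs (unwrap k t - t) < PI / 2.
Proof.
  unfold unwrap. rewrite Rplus_minus_l.
  match goal with |- Rabs (atan ?z) < _ => assert (H := atan_bound z) end.
  apply Rabs_def1; lra.
Qed.

(** * The angle of a solution *)

(** The coefficients are those of u' = P v, v' = (Q - l W) u, extended to the
    whole line with common bounds. *)
Section SturmLiouville.

Context (P Q W : R -> R) (m M : R).
Context (m_pos : 0 < m).
Context (P_cont : forall x, continuous P x) (P_bnd : forall x, m <= P x <= M).
Context (Q_cont : forall x, continuous Q x) (Q_bnd : forall x, m <= Q x <= M).
Context (W_cont : forall x, continuous W x) (W_bnd : forall x, m <= W x <= M).

Definition phase_field (l x t : R) : R :=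
  P x * (cos t * cos t) + (l * W x - Q x) * (sin t * sin t).

Definition phase_lip (l : R) : R := 2 * (M * (2 + Rabs l)).

Lemma M_pos : 0 < M.
Proof. assert (H := P_bnd 0). lra. Qed.

Lemma phase_lip_pos l : 0 < phase_lip l.
Proof. unfold phase_lip. assert (H := M_pos). assert (H' := Rabs_pos l). nra. Qed.

Lemma potential_bound l x : Rabs (l * W x - Q x - P x) <= M * (2 + Rabs l).
Proof.
  assert (H := P_bnd x). assert (H1 := Q_bnd x). assert (H2 := W_bnd x).
  assert (Hl := Rle_abs l). assert (Hl' := Rle_abs (- l)). rewrite Rabs_Ropp in Hl'.
  apply Rabs_le. split; nra.
Qed.

Lemma phase_field_lip l x y z :
  Rabs (phase_field l x y - phase_field l x z) <= phase_lip l * Rabs (y - z).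
Proof.
  unfold phase_field.
  replace (_ - _) with ((l * W x - Q x - P x) * ((sin y - sin z) * (sin y + sin z))).
  2: { assert (H := sin_sqr_add_cos_sqr y). assert (H' := sin_sqr_add_cos_sqr z).
       replace (cos y * cos y) with (1 - sin y * sin y) by lra.
       replace (cos z * cos z) with (1 - sin z * sin z) by lra. ring. }
  unfold phase_lip.
  rewrite !Rabs_mult.
  assert (H := sin_lipschitz y z).
  assert (H1 : Rabs (sin y + sin z) <= 2).
  { assert (H1 := SIN_bound y). assert (H2 := SIN_bound z). apply Rabs_le. lra. }
  assert (H2 := potential_bound l x).
  assert (H3 := Rabs_pos (sin y - sin z)). assert (H4 := Rabs_pos (sin y + sin z)).
  assert (H5 := Rabs_pos (l * W x - Q x - P x)).
  replace (2 * (M * (2 + Rabs l)) * Rabs (y - z)) with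
    ((M * (2 + Rabs l)) * (Rabs (y - z) * 2)) by ring.
  apply Rmult_le_compat; try apply Rmult_le_compat; try assumption.
  apply Rmult_le_pos; assumption.
Qed.

Lemma phase_field_continuous l (y : R -> R) :
  (forall x, continuous y x) -> forall x, continuous (fun t => phase_field l t (y t)) x.
Proof.
  intros Hy x. unfold phase_field.
  assert (Hc : continuous (fun t => cos (y t)) x).
  { apply (continuous_comp y cos). apply Hy.
    apply continuity_pt_filterlim, continuity_cos. }
  assert (Hs : continuous (fun t => sin (y t)) x).
  { apply (continuous_comp y sin). apply Hy.
    apply continuity_pt_filterlim, continuity_sin. }
  apply (continuous_plus (fun t => P t * (cos (y t) * cos (y t)))
    (fun t => (l * W t - Q t) * (sin (y t) * sin (y t)))).
  - apply (continuous_mult P (fun t => cos (y t) * cos (y t))). apply P_cont.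
    now apply (continuous_mult (fun t => cos (y t)) (fun t => cos (y t))).
  - apply (continuous_mult (fun t => l * W t - Q t) (fun t => sin (y t) * sin (y t))).
    + apply (continuous_minus (fun t => l * W t) Q).
      apply (continuous_scal_r l W), W_cont. apply Q_cont.
    + now apply (continuous_mult (fun t => sin (y t)) (fun t => sin (y t))).
Qed.

Lemma phase_field_bound l x t : Rabs (phase_field l x t) <= M * (3 + Rabs l).
Proof.
  unfold phase_field.
  assert (H := P_bnd x). assert (H' := potential_bound l x).
  assert (H1 := sin_sqr_add_cos_sqr t).
  replace (P x * (cos t * cos t) + (l * W x - Q x) * (sin t * sin t)) with
    (P x + (l * W x - Q x - P x) * (sin t * sin t)).
  2: { replace (cos t * cos t) with (1 - sin t * sin t) by lra. ring. }
  apply Rabs_le_between in H'. assert (0 <= cos t * cos t) by apply Rle_0_sqr.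
  assert (0 <= sin t * sin t) by apply Rle_0_sqr.
  apply Rabs_le. assert (H3 := M_pos). split; nra.
Qed.

Lemma phase_exists l y0 :
  exists y, y 0 = y0 /\ forall x, is_derive y x (phase_field l x (y x)).
Proof.
  apply (cauchy_lipschitz (phase_field l) (phase_lip l) (M * (3 + Rabs l))).
  - apply phase_lip_pos.
  - apply phase_field_continuous.
  - apply phase_field_lip.
  - intros t. apply phase_field_bound.
Qed.

(** The boundary conditions are v(0) = (A1 l + A2) u(0) and
    v(L) = -(B1 l + B2) u(L); the signs are chosen to make all four constants
    positive. *)
Context (L A1 A2 B1 B2 : R).
Context (L_pos : 0 < L) (A1_pos : 0 < A1) (A2_pos : 0 < A2) (B1_pos : 0 < B1) (B2_pos : 0 < B2).

Definition phase (l : R) : R -> R :=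
  proj1_sig (constructive_indefinite_description _ (phase_exists l (arccot (A1 * l + A2)))).

Lemma phase_0 l : phase l 0 = arccot (A1 * l + A2).
Proof.
  unfold phase. destruct constructive_indefinite_description as [y Hy]. apply Hy.
Qed.

Lemma phase_derive l x : is_derive (phase l) x (phase_field l x (phase l x)).
Proof.
  unfold phase. destruct constructive_indefinite_description as [y Hy]. apply Hy.
Qed.

Lemma phase_continuous l x : continuous (phase l) x.
Proof. apply (ex_derive_continuous (phase l)). eexists. apply phase_derive. Qed.

(** At a multiple of PI the angle moves with speed P > 0. *)
Lemma phase_crosses l x k : phase l x = IZR k * PI -> crosses_up (phase l) (IZR k * PI) x.
Proof.
  intros E. rewrite <- E. apply (crosses_up_derive _ _ _ (phase_derive l x)).
  unfold phase_field.
  assert (Hs : sin (phase l x) = 0) by (apply sin_eq_0_1; eauto).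
  assert (H := sin_sqr_add_cos_sqr (phase l x)). rewrite Hs in *.
  assert (H' := P_bnd x). nra.
Qed.

Lemma phase_above l k a b :
  a < b -> IZR k * PI <= phase l a -> IZR k * PI < phase l b.
Proof.
  intros Hab. apply crosses_up_above; [|intros; now apply phase_crosses|exact Hab].
  intros; apply phase_continuous.
Qed.

Lemma phase_pos l x : 0 <= x -> 0 < phase l x.
Proof.
  intros Hx. assert (H : 0 < phase l 0) by (rewrite phase_0; apply arccot_bound).
  destruct (Req_dec x 0) as [->|]; [exact H|].
  assert (H1 := phase_above l 0 0 x). rewrite Rmult_0_l in H1. apply H1; lra.
Qed.

(** At an odd multiple of PI/2 the angle moves with speed l W - Q, which is
    negative for [l <= 0]. *)
Lemma phase_below l c x :
  l <= 0 -> cos c = 0 -> 0 <= x -> phase l 0 < c -> phase l x < c.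
Proof.
  intros Hl Hc Hx H0.
  destruct (Req_dec x 0) as [->|]; [exact H0|].
  assert (- c < - phase l x); [|lra].
  apply (crosses_up_above (fun t => - phase l t) (- c) 0 x); try lra.
  - intros t _. apply (continuous_opp (phase l)), phase_continuous.
  - intros t _ E. rewrite <- E.
    apply (crosses_up_derive (fun t => - phase l t) t (- phase_field l t (phase l t))).
    + apply (is_derive_opp (phase l)), phase_derive.
    + unfold phase_field. replace (phase l t) with c by lra.
      assert (H1 := sin_sqr_add_cos_sqr c). rewrite Hc in *.
      replace (sin c * sin c) with 1 by lra.
      assert (H2 := Q_bnd t). assert (H3 := W_bnd t). nra.
Qed.

Definition target (l : R) : R := arccot (- (B1 * l + B2)).

Definition gap (l : R) : R := phase l L - target l.

Lemma phase_close l e : 0 < e ->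
  exists d, 0 < d /\ forall mu, Rabs (mu - l) < d ->
    forall x, 0 <= x <= L -> Rabs (phase mu x - phase l x) < e.
Proof.
  intros He. set (K := phase_lip l).
  assert (HK : 0 < K) by apply phase_lip_pos.
  (* The difference of the angles stays below eta exp((K+1) x), where eta bounds
     both its initial value and the change of the right-hand side. *)
  set (eta := e / (2 * exp ((K + 1) * L))).
  assert (HeL := exp_pos ((K + 1) * L)).
  assert (Heta : 0 < eta) by (apply Rdiv_lt_0_compat; lra).
  assert (C : continuous (fun s => arccot (A1 * s + A2)) l).
  { apply (continuous_comp (fun s => A1 * s + A2) arccot).
    apply (ex_derive_continuous (fun s => A1 * s + A2)). auto_derive. exact I.
    apply arccot_continuous. }
  destruct (proj1 (filterlim_locally _ _) C (mkposreal _ Heta)) as [d1 Hd1].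
  assert (HM := M_pos).
  assert (Hd2 : 0 < eta / M) by (apply Rdiv_lt_0_compat; lra).
  exists (Rmin d1 (eta / M)). split. { apply Rmin_case; [apply cond_pos|exact Hd2]. }
  intros mu Hmu x Hx.
  assert (H1 : Rabs (phase mu 0 - phase l 0) < eta).
  { rewrite !phase_0. apply (Hd1 mu). exact (Rlt_le_trans _ _ _ Hmu (Rmin_l _ _)). }
  assert (H2 : Rabs (mu - l) * M < eta).
  { replace eta with (eta / M * M) by (field; lra). apply Rmult_lt_compat_r; [lra|].
    exact (Rlt_le_trans _ _ _ Hmu (Rmin_r _ _)). }
  assert (H3 : forall t,
    Rabs (phase_field mu t (phase mu t) - phase_field l t (phase mu t)) <= eta).
  { intros t. unfold phase_field.
    match goal with |- Rabs ?a <= _ => replace a with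
      ((mu - l) * (W t * (sin (phase mu t) * sin (phase mu t)))) by ring end.
    rewrite Rabs_mult. refine (Rle_trans _ _ _ _ (Rlt_le _ _ H2)).
    apply Rmult_le_compat_l; [apply Rabs_pos|].
    assert (H4 := sin_sqr_add_cos_sqr (phase mu t)). assert (H5 := W_bnd t).
    assert (0 <= cos (phase mu t) * cos (phase mu t)) by apply Rle_0_sqr.
    assert (0 <= sin (phase mu t) * sin (phase mu t)) by apply Rle_0_sqr.
    apply Rabs_le. nra. }
  (* The sign s stands for the two halves of the absolute value. *)
  assert (G : forall s, (s = 1 \/ s = -1) ->
    s * (phase mu x - phase l x) - eta * exp ((K + 1) * x) <= 0).
  { intros s Hs.
    apply (gronwall_nonpos
      (fun t => s * (phase mu t - phase l t) - eta * exp ((K + 1) * t))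
      (fun t => s * (phase_field mu t (phase mu t) - phase_field l t (phase l t))
        - eta * ((K + 1) * exp ((K + 1) * t))) 0 x K); [lra| | | |].
    - intros t _.
      apply (ex_derive_continuous
        (fun t => s * (phase mu t - phase l t) - eta * exp ((K + 1) * t))).
      auto_derive. repeat split; eexists; apply phase_derive.
    - intros t _. auto_derive. { repeat split; eexists; apply phase_derive. }
      rewrite (is_derive_unique _ _ _ (phase_derive mu t) : Derive (fun t : R => phase mu t) t = _).
      rewrite (is_derive_unique _ _ _ (phase_derive l t) : Derive (fun t : R => phase l t) t = _).
      ring.
    - intros t Ht Hp. cbv beta in Hp |- *.
      assert (H4 := H3 t). assert (H5 := phase_field_lip l t (phase mu t) (phase l t)).
      fold K in H5.
      assert (He1 : 1 <= exp ((K + 1) * t)).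
      { assert (H6 := exp_ineq1_le ((K + 1) * t)).
        assert (0 <= (K + 1) * t) by (apply Rmult_le_pos; lra). lra. }
      assert (He2 : eta <= eta * exp ((K + 1) * t)).
      { rewrite <- (Rmult_1_r eta) at 1. apply Rmult_le_compat_l; lra. }
      assert (Hs1 : Rabs (phase mu t - phase l t) = s * (phase mu t - phase l t)).
      { destruct Hs as [-> | ->]; [rewrite Rabs_pos_eq|rewrite Rabs_left]; lra. }
      rewrite Hs1 in H5.
      apply Rabs_le_between in H4, H5.
      destruct Hs as [-> | ->]; lra.
    - rewrite Rmult_0_r, exp_0. apply Rabs_def2 in H1.
      destruct Hs as [-> | ->]; lra. }
  assert (H6 : eta * exp ((K + 1) * x) < e).
  { apply Rle_lt_trans with (eta * exp ((K + 1) * L)).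
    - apply Rmult_le_compat_l; [lra|]. apply exp_nondecreasing, Rmult_le_compat_l; lra.
    - unfold eta. field_simplify; lra. }
  assert (G1 := G 1 (or_introl eq_refl)). assert (G2 := G (-1) (or_intror eq_refl)).
  apply Rabs_def1; lra.
Qed.

Lemma target_continuous l : continuous target l.
Proof.
  apply (continuous_comp (fun s => - (B1 * s + B2)) arccot).
  apply (ex_derive_continuous (fun s => - (B1 * s + B2))). auto_derive. exact I.
  apply arccot_continuous.
Qed.

Lemma gap_continuous l : continuous gap l.
Proof.
  apply (continuous_minus (fun l => phase l L) target); [|apply target_continuous].
  apply filterlim_locally. intros e.
  destruct (phase_close l e (cond_pos e)) as [d [Hd H]].
  exists (mkposreal d Hd). intros mu Hmu. apply (H mu Hmu L). lra.
Qed.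

(** * The solution with the given initial angle *)

(** The logarithm of rho, from rho' = (P + Q - l W) rho sin phi cos phi. *)
Definition log_amplitude (l x : R) : R :=
  RInt (fun t => (P t + Q t - l * W t) * (sin (phase l t) * cos (phase l t))) 0 x.

Definition sol (l x : R) : R := exp (log_amplitude l x) * sin (phase l x).
Definition sol_flux (l x : R) : R := exp (log_amplitude l x) * cos (phase l x).

Lemma log_amplitude_derive l x : is_derive (log_amplitude l) x
  ((P x + Q x - l * W x) * (sin (phase l x) * cos (phase l x))).
Proof.
  apply (derive_RInt_continuous
    (fun t => (P t + Q t - l * W t) * (sin (phase l t) * cos (phase l t)))).
  intros t.
  assert (Hc : continuous (fun t => cos (phase l t)) t).
  { apply (continuous_comp (phase l) cos). apply phase_continuous.
    apply continuity_pt_filterlim, continuity_cos. }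
  assert (Hs : continuous (fun t => sin (phase l t)) t).
  { apply (continuous_comp (phase l) sin). apply phase_continuous.
    apply continuity_pt_filterlim, continuity_sin. }
  apply (continuous_mult (fun t => P t + Q t - l * W t)
    (fun t => sin (phase l t) * cos (phase l t))).
  - apply (continuous_minus (fun t => P t + Q t) (fun t => l * W t)).
    now apply (continuous_plus P Q).
    now apply (continuous_scal_r l W).
  - now apply (continuous_mult (fun t => sin (phase l t)) (fun t => cos (phase l t))).
Qed.

Lemma sol_derive l x : is_derive (sol l) x (P x * sol_flux l x).
Proof.
  unfold sol, sol_flux.
  assert (H1 := log_amplitude_derive l x). assert (H2 := phase_derive l x).
  auto_derive. { repeat split; eexists; [exact H1|exact H2]. }
  rewrite (is_derive_unique _ _ _ H1 : Derive (fun t : R => log_amplitude l t) x = _).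
  rewrite (is_derive_unique _ _ _ H2 : Derive (fun t : R => phase l t) x = _).
  unfold phase_field. assert (H := sin_sqr_add_cos_sqr (phase l x)).
  set (s := sin (phase l x)) in *. set (c := cos (phase l x)) in *.
  set (E := exp _).
  transitivity (P x * (E * c) * (s * s + c * c)); [ring|rewrite H; ring].
Qed.

Lemma sol_flux_derive l x : is_derive (sol_flux l) x ((Q x - l * W x) * sol l x).
Proof.
  unfold sol, sol_flux.
  assert (H1 := log_amplitude_derive l x). assert (H2 := phase_derive l x).
  auto_derive. { repeat split; eexists; [exact H1|exact H2]. }
  rewrite (is_derive_unique _ _ _ H1 : Derive (fun t : R => log_amplitude l t) x = _).
  rewrite (is_derive_unique _ _ _ H2 : Derive (fun t : R => phase l t) x = _).
  unfold phase_field. assert (H := sin_sqr_add_cos_sqr (phase l x)).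
  set (s := sin (phase l x)) in *. set (c := cos (phase l x)) in *.
  set (E := exp _).
  transitivity ((Q x - l * W x) * (E * s) * (s * s + c * c)); [ring|rewrite H; ring].
Qed.

Lemma sol_continuous l x : continuous (sol l) x.
Proof. apply (ex_derive_continuous (sol l)). eexists. apply sol_derive. Qed.

Lemma sol_flux_continuous l x : continuous (sol_flux l) x.
Proof. apply (ex_derive_continuous (sol_flux l)). eexists. apply sol_flux_derive. Qed.

Lemma sol_flux_0 l : sol_flux l 0 = (A1 * l + A2) * sol l 0.
Proof. unfold sol_flux, sol. rewrite phase_0, cos_arccot. ring. Qed.

Lemma sol_0_pos l : 0 < sol l 0.
Proof.
  unfold sol. apply Rmult_lt_0_compat; [apply exp_pos|].
  rewrite phase_0. apply sin_arccot_pos.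
Qed.

Definition defect (l : R) : R := sol_flux l L + (B1 * l + B2) * sol l L.

Lemma defect_gap l :
  defect l * sin (target l) = - exp (log_amplitude l L) * sin (gap l).
Proof.
  unfold defect, gap, sol, sol_flux. rewrite sin_minus.
  assert (H := cos_arccot (- (B1 * l + B2))). fold (target l) in H. rewrite H. ring.
Qed.

Lemma sin_target_pos l : 0 < sin (target l).
Proof. apply sin_arccot_pos. Qed.

Lemma defect_zero_iff l : defect l = 0 <-> sin (gap l) = 0.
Proof.
  assert (H := defect_gap l). assert (H1 := sin_target_pos l).
  assert (H2 := exp_pos (log_amplitude l L)).
  split; intros E; rewrite E in H; nra.
Qed.

(** * The direction in which the gap crosses multiples of PI *)

(** Lagrange's identity for the parameters [l] and [mu], combined with the
    derivative of v1 u2 so that the weight W, which enters the indefinite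
    form, cancels and only the positive form is left. *)
Lemma lagrange_derive (u1 v1 u2 v2 : R -> R) l mu x :
  is_derive u1 x (P x * v1 x) -> is_derive v1 x ((Q x - l * W x) * u1 x) ->
  is_derive u2 x (P x * v2 x) -> is_derive v2 x ((Q x - mu * W x) * u2 x) ->
  is_derive (fun t => l * (u1 t * v2 t - v1 t * u2 t) + (l - mu) * (v1 t * u2 t)) x
    ((l - mu) * (P x * (v1 x * v2 x) + Q x * (u1 x * u2 x))).
Proof.
  intros H1 H2 H3 H4. auto_derive.
  { repeat split; eexists; first [exact H1|exact H2|exact H3|exact H4]. }
  rewrite (is_derive_unique _ _ _ H1 : Derive (fun t : R => u1 t) x = _).
  rewrite (is_derive_unique _ _ _ H2 : Derive (fun t : R => v1 t) x = _).
  rewrite (is_derive_unique _ _ _ H3 : Derive (fun t : R => u2 t) x = _).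
  rewrite (is_derive_unique _ _ _ H4 : Derive (fun t : R => v2 t) x = _).
  ring.
Qed.

(** In terms of the forms A and B, l u(L) defect(mu) = (l - mu) A(u_l, u_mu)
    at an eigenvalue [l]. The hypotheses make the integral and the boundary
    term at L in A(u_l, u_mu) nonnegative; the boundary term at 0 is
    positive anyway. *)
Lemma defect_sign_near l mu :
  defect l = 0 -> l <> mu ->
  (forall x, 0 <= x <= L ->
    0 <= P x * (sol_flux l x * sol_flux mu x) + Q x * (sol l x * sol mu x)) ->
  0 <= sol l L * sol mu L ->
  0 < (l - mu) * (l * sol l L * defect mu).
Proof.
  intros HD Hne Hpos HL.
  set (H := fun x => (l - mu) * (l * (sol l x * sol_flux mu x - sol_flux l x * sol mu x)
    + (l - mu) * (sol_flux l x * sol mu x))).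
  assert (HdH : forall x, is_derive H x ((l - mu) * ((l - mu) *
      (P x * (sol_flux l x * sol_flux mu x) + Q x * (sol l x * sol mu x))))).
  { intros x. apply (is_derive_scal
      (fun x => l * (sol l x * sol_flux mu x - sol_flux l x * sol mu x)
    + (l - mu) * (sol_flux l x * sol mu x)) x (l - mu)).
    apply lagrange_derive;
    [apply sol_derive|apply sol_flux_derive|apply sol_derive|apply sol_flux_derive]. }
  assert (HH : H 0 <= H L).
  { apply (le_of_derive_nonneg H (fun x => (l - mu) * ((l - mu) *
      (P x * (sol_flux l x * sol_flux mu x) + Q x * (sol l x * sol mu x))))).
    - lra.
    - intros x _. apply (ex_derive_continuous H). eexists. apply HdH.
    - intros x _. apply HdH.
    - intros x Hx. rewrite <- Rmult_assoc.
      apply Rmult_le_pos; [apply Rle_0_sqr|]. apply Hpos. lra. }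
  assert (H0 : 0 < H 0).
  { unfold H. rewrite !sol_flux_0.
    replace (_ * _) with (((l - mu) * (l - mu)) * (A2 * (sol l 0 * sol mu 0))) by ring.
    assert (H1 := sol_0_pos l). assert (H2 := sol_0_pos mu).
    assert (0 < (l - mu) * (l - mu)) by (apply Rsqr_pos_lt; lra).
    apply Rmult_lt_0_compat; [assumption|]. apply Rmult_lt_0_compat; [assumption|].
    apply Rmult_lt_0_compat; assumption. }
  assert (E : (l - mu) * (l * sol l L * defect mu) =
    H L + (l - mu) * (l - mu) * (B2 * (sol l L * sol mu L))).
  { unfold H. unfold defect in *.
    replace (sol_flux l L) with (- ((B1 * l + B2) * sol l L)) by lra. ring. }
  rewrite E. assert (0 <= (l - mu) * (l - mu)) by apply Rle_0_sqr.
  assert (0 <= B2 * (sol l L * sol mu L)) by (apply Rmult_le_pos; lra).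
  assert (0 <= (l - mu) * (l - mu) * (B2 * (sol l L * sol mu L))) by (apply Rmult_le_pos; lra).
  lra.
Qed.

(** The solution for a nearby [mu] has almost the same angle, so A(u_l, u_mu)
    inherits the sign of A(u_l, u_l), and defect_sign_near applies. Only the
    closeness of the angles is used, as the amplitudes factor out. *)
Lemma gap_crossing l : l <> 0 -> sin (gap l) = 0 ->
  exists d, 0 < d /\ forall mu, mu <> l -> Rabs (mu - l) < d ->
    0 < l * (mu - l) * (gap mu - gap l).
Proof.
  intros Hl Hs.
  assert (HD := proj2 (defect_zero_iff l) Hs).
  assert (Hc : cos (gap l) * cos (gap l) = 1).
  { assert (H := sin_sqr_add_cos_sqr (gap l)). rewrite Hs in H. lra. }
  assert (HsL : sin (phase l L) = sin (target l) * cos (gap l)).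
  { replace (phase l L) with (target l + gap l) by (unfold gap; ring).
    rewrite sin_plus, Hs. ring. }
  assert (Ht := sin_target_pos l).
  assert (HM := M_pos).
  (* The first bound keeps P cos cos + Q sin sin >= m - 2 M e nonnegative, the
     second one keeps the product of the two solutions at L nonnegative. *)
  set (e := Rmin (m / M / 2) (sin (target l) * sin (target l))).
  assert (HmM : 0 < m / M) by (apply Rdiv_lt_0_compat; lra).
  assert (He : 0 < e).
  { unfold e. apply Rmin_case; [lra|]. nra. }
  destruct (phase_close l e He) as [d1 [Hd1 Hclose]].
  destruct (proj1 (filterlim_locally _ _) (gap_continuous l) (mkposreal 1 Rlt_0_1)) as [d2 Hd2].
  exists (Rmin d1 d2). split. { apply Rmin_case; [exact Hd1|apply cond_pos]. }
  intros mu Hne Hmu.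
  assert (Hc1 := Hclose mu (Rlt_le_trans _ _ _ Hmu (Rmin_l _ _))).
  assert (Hc2 : Rabs (gap mu - gap l) < 1)
    by exact (Hd2 mu (Rlt_le_trans _ _ _ Hmu (Rmin_r _ _))).
  assert (Hprod : forall x, 0 <= x <= L ->
    sin (phase l x) * sin (phase l x) - e <= sin (phase l x) * sin (phase mu x) /\
    cos (phase l x) * cos (phase l x) - e <= cos (phase l x) * cos (phase mu x)).
  { intros x Hx. assert (H := Hc1 x Hx).
    assert (H1 := sin_lipschitz (phase mu x) (phase l x)).
    assert (H2 := cos_lipschitz (phase mu x) (phase l x)).
    assert (H3 := SIN_bound (phase l x)). assert (H4 := COS_bound (phase l x)).
    assert (H5 := Rle_lt_trans _ _ _ H1 H). assert (H6 := Rle_lt_trans _ _ _ H2 H).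
    apply Rabs_def2 in H5, H6. split; nra. }
  assert (T := defect_sign_near l mu HD (not_eq_sym Hne)).
  assert (T' : 0 < (l - mu) * (l * sol l L * defect mu)).
  { apply T.
    - intros x Hx. destruct (Hprod x Hx) as [H1 H2].
      unfold sol, sol_flux.
      assert (Ha := exp_pos (log_amplitude l x)). assert (Hb := exp_pos (log_amplitude mu x)).
      replace (_ + _) with ((exp (log_amplitude l x) * exp (log_amplitude mu x)) *
        (P x * (cos (phase l x) * cos (phase mu x)) +
         Q x * (sin (phase l x) * sin (phase mu x)))) by ring.
      apply Rmult_le_pos. { apply Rlt_le, Rmult_lt_0_compat; assumption. }
      assert (HP := P_bnd x). assert (HQ := Q_bnd x).
      assert (He1 : e <= m / M / 2) by apply Rmin_l.
      assert (He2 : 2 * M * e <= m).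
      { replace m with (2 * M * (m / M / 2)) by (field; lra). apply Rmult_le_compat_l; lra. }
      assert (H3 := sin_sqr_add_cos_sqr (phase l x)).
      assert (H4 : 0 <= sin (phase l x) * sin (phase l x)) by apply Rle_0_sqr.
      assert (H5 : 0 <= cos (phase l x) * cos (phase l x)) by apply Rle_0_sqr.
      assert (H6 : P x * (cos (phase l x) * cos (phase l x) - e)
        <= P x * (cos (phase l x) * cos (phase mu x))) by (apply Rmult_le_compat_l; lra).
      assert (H7 : Q x * (sin (phase l x) * sin (phase l x) - e)
        <= Q x * (sin (phase l x) * sin (phase mu x))) by (apply Rmult_le_compat_l; lra).
      nra.
    - destruct (Hprod L ltac:(lra)) as [H1 _].
      unfold sol.
      assert (Ha := exp_pos (log_amplitude l L)). assert (Hb := exp_pos (log_amplitude mu L)).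
      replace (_ * _) with ((exp (log_amplitude l L) * exp (log_amplitude mu L)) *
         (sin (phase l L) * sin (phase mu L))) by ring.
      apply Rmult_le_pos. { apply Rlt_le, Rmult_lt_0_compat; assumption. }
      assert (He1 : e <= sin (target l) * sin (target l)) by apply Rmin_r.
      rewrite HsL in *.
      replace (sin (target l) * cos (gap l) * (sin (target l) * cos (gap l))) with
        (sin (target l) * sin (target l) * (cos (gap l) * cos (gap l))) in H1 by ring.
      rewrite Hc in H1. lra. }
  assert (HG := defect_gap mu).
  assert (Hmt := sin_target_pos mu).
  assert (Hamu := exp_pos (log_amplitude mu L)). assert (Hal := exp_pos (log_amplitude l L)).
  set (D := gap mu - gap l) in *.
  assert (HsD : sin (gap mu) = sin D * cos (gap l)).
  { replace (gap mu) with (D + gap l) by (unfold D; ring). rewrite sin_plus, Hs. ring. }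
  assert (H8 : 0 < l * (mu - l) * sin D).
  { assert (H9 : 0 < (l - mu) * (l * sol l L * defect mu) * sin (target mu))
      by (apply Rmult_lt_0_compat; assumption).
    replace ((l - mu) * (l * sol l L * defect mu) * sin (target mu)) with
      ((l - mu) * (l * sol l L * (defect mu * sin (target mu)))) in H9 by ring.
    rewrite HG, HsD in H9. unfold sol in H9. rewrite HsL in H9.
    match type of H9 with 0 < ?a => replace a with
      ((l * (mu - l) * sin D) * (exp (log_amplitude l L) * exp (log_amplitude mu L) *
        sin (target l) * (cos (gap l) * cos (gap l)))) in H9 by ring end.
    rewrite Hc, Rmult_1_r in H9.
    apply (Rmult_lt_reg_r (exp (log_amplitude l L) * exp (log_amplitude mu L) * sin (target l))).
    repeat apply Rmult_lt_0_compat; assumption. lra. }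
  assert (HPI : 2 < PI) by (assert (H := PI2_1); lra).
  apply Rabs_def2 in Hc2.
  destruct (Rtotal_order D 0) as [h|[h|h]].
  - assert (sin D < 0) by (apply sin_lt_0_var; lra). nra.
  - rewrite h, sin_0 in H8. lra.
  - assert (0 < sin D) by (apply sin_gt_0; lra). nra.
Qed.

(** * The range of the gap *)
Lemma gap_above k a b : 0 < a -> a < b -> IZR k * PI <= gap a -> IZR k * PI < gap b.
Proof.
  intros Ha Hab. apply crosses_up_above; [intros; apply gap_continuous| |exact Hab].
  intros c Hc E.
  destruct (gap_crossing c) as [d [Hd H]]. lra. rewrite E. apply sin_IZR_PI.
  exists d. split; [exact Hd|]. intros y. rewrite E in H. split; intros Hy.
  - assert (H1 := H y ltac:(lra) ltac:(apply Rabs_def1; lra)).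
    assert (0 < c * (y - c)) by (apply Rmult_lt_0_compat; lra). nra.
  - assert (H1 := H y ltac:(lra) ltac:(apply Rabs_def1; lra)).
    assert (0 < c * (c - y)) by (apply Rmult_lt_0_compat; lra). nra.
Qed.

Lemma gap_above_neg k a b : b < 0 -> a < b -> IZR k * PI <= gap b -> IZR k * PI < gap a.
Proof.
  intros Hb Hab Hk.
  assert (H : IZR k * PI < (fun x => gap (- x)) (- a)).
  2: { cbv beta in H. now rewrite Ropp_involutive in H. }
  apply (crosses_up_above (fun x => gap (- x)) (IZR k * PI) (- b) (- a)).
  - intros x _. apply (continuous_comp (fun x => - x) gap).
    apply (continuous_opp (fun y => y) x), continuous_id. apply gap_continuous.
  - intros c Hc E.
    destruct (gap_crossing (- c)) as [d [Hd H]]. lra. rewrite E. apply sin_IZR_PI.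
    exists d. split; [exact Hd|]. intros y. rewrite E in H. split; intros Hy.
    + assert (H1 := H (- y) ltac:(lra) ltac:(apply Rabs_def1; lra)).
      assert (0 < c * (y - c)) by (apply Rmult_lt_0_compat; lra). nra.
    + assert (H1 := H (- y) ltac:(lra) ltac:(apply Rabs_def1; lra)).
      assert (0 < c * (c - y)) by (apply Rmult_lt_0_compat; lra). nra.
  - lra.
  - now rewrite Ropp_involutive.
Qed.

Lemma gap_gt_opp_PI l : - PI < gap l.
Proof.
  unfold gap. assert (H := phase_pos l L ltac:(lra)).
  assert (H1 := arccot_bound (- (B1 * l + B2))). unfold target. lra.
Qed.

(** For [l <= 0] the angle cannot pass 3 PI / 2: this is why only two
    eigenvalues are negative. *)
Lemma gap_lt_2PI_of_nonpos l : l <= 0 -> gap l < 2 * PI.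
Proof.
  intros Hl. unfold gap.
  assert (H := phase_below l (3 * (PI / 2)) L Hl cos_3PI2 ltac:(lra)).
  assert (H1 := arccot_bound (- (B1 * l + B2))). unfold target.
  rewrite phase_0 in H. assert (H2 := arccot_bound (A1 * l + A2)).
  assert (H3 := PI_RGT_0). lra.
Qed.

(** For l = 0 the angle starts below PI/2 and stays there, while the target
    is above PI/2. *)
Lemma gap_0_neg : gap 0 < 0.
Proof.
  unfold gap, target.
  assert (H := phase_below 0 (PI / 2) L ltac:(lra) cos_PI2 ltac:(lra)).
  rewrite phase_0 in H.
  assert (H1 := arccot_lt_PI2 (A1 * 0 + A2) ltac:(lra)).
  assert (H2 := arccot_gt_PI2 (- (B1 * 0 + B2)) ltac:(lra)). lra.
Qed.

(** Here phi' >= m (cos^2 phi + k^2 sin^2 phi) when l m = m k^2 + M, and then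
    the angle [unwrap k (phase l x)] grows at least at the rate k m. *)
Lemma gap_unbounded c : exists l, 0 < l /\ c <= gap l.
Proof.
  assert (HPI := PI_RGT_0). assert (HM := M_pos).
  (* A total growth of |c| + 2 PI is wanted: PI is lost by passing between the
     angle and its unwrapped version at both ends, PI by the target. *)
  set (k := (Rabs c + 2 * PI) / (m * L)).
  assert (HmL : 0 < m * L) by (apply Rmult_lt_0_compat; assumption).
  assert (Hk : 0 < k).
  { apply Rdiv_lt_0_compat; [|exact HmL]. assert (H := Rabs_pos c). lra. }
  set (l := (m * (k * k) + M) / m).
  assert (Hkk : 0 < m * (k * k))
    by (apply Rmult_lt_0_compat; [|apply Rmult_lt_0_compat]; assumption).
  assert (Hl : 0 < l) by (apply Rdiv_lt_0_compat; lra).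
  exists l. split; [exact Hl|].
  assert (Hlm : l * m = m * (k * k) + M) by (unfold l; field; lra).
  assert (H : unwrap k (phase l 0) - k * m * 0 <= unwrap k (phase l L) - k * m * L).
  { assert (Hd : forall x, is_derive (fun x => unwrap k (phase l x) - k * m * x) x
      (phase_field l x (phase l x) *
        (k / (cos (phase l x) * cos (phase l x) + k * k * (sin (phase l x) * sin (phase l x))))
       - k * m)).
    { intros x. apply (is_derive_minus (fun x => unwrap k (phase l x)) (fun x => k * m * x)).
      - apply (is_derive_comp (unwrap k) (phase l)). now apply unwrap_derive. apply phase_derive.
      - auto_derive; [exact I|ring]. }
    apply (le_of_derive_nonneg (fun x => unwrap k (phase l x) - k * m * x) _ 0 L ltac:(lra)) with
      (2 := fun x _ => Hd x).
    - intros x _. apply (ex_derive_continuous (fun x => unwrap k (phase l x) - k * m * x)).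
      eexists. apply Hd.
    - intros x _. unfold phase_field.
      assert (HD := weighted_square_pos (k * k) (phase l x) ltac:(nra)).
      assert (H0 : 0 <= sin (phase l x) * sin (phase l x)) by apply Rle_0_sqr.
      assert (H1 : 0 <= cos (phase l x) * cos (phase l x)) by apply Rle_0_sqr.
      set (s := sin (phase l x) * sin (phase l x)) in *.
      set (c' := cos (phase l x) * cos (phase l x)) in *.
      assert (HP := P_bnd x). assert (HQ := Q_bnd x). assert (HW := W_bnd x).
      assert (HF : m * (c' + k * k * s) <= P x * c' + (l * W x - Q x) * s).
      { assert (m * c' <= P x * c') by (apply Rmult_le_compat_r; lra).
        assert (l * m <= l * W x) by (apply Rmult_le_compat_l; lra).
        assert (m * (k * k) * s <= (l * W x - Q x) * s) by (apply Rmult_le_compat_r; lra).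
        lra. }
      replace (_ - _) with ((P x * c' + (l * W x - Q x) * s - m * (c' + k * k * s)) *
        (k / (c' + k * k * s))) by (field; lra).
      apply Rmult_le_pos; [lra|]. apply Rlt_le, Rdiv_lt_0_compat; assumption. }
  assert (E : k * m * L = Rabs c + 2 * PI) by (unfold k; field; lra).
  assert (N0 := unwrap_near k (phase l 0)). assert (N1 := unwrap_near k (phase l L)).
  apply Rabs_def2 in N0, N1.
  assert (H0 := phase_pos l 0 ltac:(lra)).
  assert (H1 := arccot_bound (- (B1 * l + B2))). unfold gap, target.
  assert (H2 := Rle_abs c). lra.
Qed.

(** The growth of [gap] is at most linear; this makes the eigenvalues tend to
    infinity. *)
Lemma gap_upper l : 0 <= l -> gap l <= PI + M * (1 + l) * L.
Proof.
  intros Hl.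
  assert (H : M * (1 + l) * 0 - phase l 0 <= M * (1 + l) * L - phase l L).
  { assert (Hd : forall x, is_derive (fun x => M * (1 + l) * x - phase l x) x
      (M * (1 + l) - phase_field l x (phase l x))).
    { intros x. apply (is_derive_minus (fun x => M * (1 + l) * x) (phase l)).
      - auto_derive; [exact I|ring].
      - apply phase_derive. }
    apply (le_of_derive_nonneg (fun x => M * (1 + l) * x - phase l x) _ 0 L ltac:(lra)) with
      (2 := fun x _ => Hd x).
    - intros x _. apply (ex_derive_continuous (fun x => M * (1 + l) * x - phase l x)).
      eexists. apply Hd.
    - intros x _. unfold phase_field.
      assert (H := sin_sqr_add_cos_sqr (phase l x)).
      assert (H0 : 0 <= sin (phase l x) * sin (phase l x)) by apply Rle_0_sqr.
      assert (H1 : 0 <= cos (phase l x) * cos (phase l x)) by apply Rle_0_sqr.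
      set (s := sin (phase l x) * sin (phase l x)) in *.
      set (c := cos (phase l x) * cos (phase l x)) in *.
      assert (HP := P_bnd x). assert (HQ := Q_bnd x). assert (HW := W_bnd x).
      assert (P x * c <= M * c) by (apply Rmult_le_compat_r; lra).
      assert (l * W x <= l * M) by (apply Rmult_le_compat_l; lra).
      assert ((l * W x - Q x) * s <= (l * M) * s) by (apply Rmult_le_compat_r; lra).
      assert (0 <= l * M) by (apply Rmult_le_pos; lra).
      assert (M * c <= M) by nra.
      assert (l * M * s <= l * M) by nra.
      lra. }
  rewrite phase_0 in H. assert (H0 := arccot_bound (A1 * l + A2)).
  assert (H1 := arccot_bound (- (B1 * l + B2))). unfold gap, target. lra.
Qed.

(** The tangent of the angle satisfies tau' = P - (Q - l W) tau^2, so a linear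
    function with slope at most m - M (1 - l) tau^2 is a subsolution, for
    the branch of the angle near PI. *)
Lemma phase_above_linear l slope t0 :
  l <= 0 -> 0 <= slope ->
  (forall x, 0 <= x <= L -> slope <= m - M * (1 - l) * ((t0 + slope * x) * (t0 + slope * x))) ->
  PI + atan t0 <= phase l 0 ->
  PI + atan (t0 + slope * L) <= phase l L.
Proof.
  intros Hl Hs Hsub H0.
  set (tau := fun x => t0 + slope * x) in *.
  set (phi := fun x => PI + atan (tau x)).
  assert (Hphi : forall x, is_derive phi x (slope * / (1 + (tau x)²))).
  { intros x. rewrite <- (Rplus_0_l (slope * _)).
    apply (is_derive_plus (fun _ => PI) (fun x => atan (tau x))).
    apply (is_derive_const PI).
    apply (is_derive_comp atan tau). apply is_derive_atan.
    unfold tau. auto_derive; [exact I|ring]. }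
  assert (Hd : forall x, is_derive (fun x => phi x - phase l x) x
    (slope * / (1 + (tau x)²) - phase_field l x (phase l x))).
  { intros x. apply (is_derive_minus phi (phase l)). apply Hphi. apply phase_derive. }
  assert (G : phi L - phase l L <= 0); [|unfold phi, tau in G; lra].
  apply (gronwall_nonpos (fun x => phi x - phase l x)
    (fun x => slope * / (1 + (tau x)²) - phase_field l x (phase l x)) 0 L (phase_lip l)).
  - lra.
  - intros x _. apply (ex_derive_continuous (fun x => phi x - phase l x)). eexists; apply Hd.
  - intros x _. apply Hd.
  - intros x Hx Hp. cbv beta in Hp |- *.
    assert (H1 := phase_field_lip l x (phi x) (phase l x)).
    rewrite (Rabs_pos_eq (phi x - phase l x)) in H1 by lra.
    apply Rabs_le_between in H1.
    assert (H2 : slope * / (1 + (tau x)²) <= phase_field l x (phi x)); [|lra].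
    unfold phase_field, phi, Rsqr.
    assert (Hc := cos_atan_sqr (tau x)).
    rewrite (Rplus_comm PI), neg_cos, neg_sin.
    set (c := cos (atan (tau x))) in *.
    assert (Hss : sin (atan (tau x)) = tau x * c).
    { rewrite <- (tan_atan (tau x)) at 2. unfold tan, c. field.
      assert (Hb := atan_bound (tau x)). apply Rgt_not_eq, cos_gt_0; lra. }
    rewrite Hss.
    assert (Ht : 0 <= tau x * tau x) by apply Rle_0_sqr.
    replace (/ (1 + tau x * tau x)) with (c * c)
      by (apply (Rmult_eq_reg_r (1 + tau x * tau x)); [rewrite Hc; field|]; lra).
    replace (P x * (- c * - c) + (l * W x - Q x) * (- (tau x * c) * - (tau x * c))) with
      ((P x + (l * W x - Q x) * (tau x * tau x)) * (c * c)) by ring.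
    apply Rmult_le_compat_r; [apply Rle_0_sqr|].
    assert (HP := P_bnd x). assert (HQ := Q_bnd x). assert (HW := W_bnd x).
    assert (H3 := Hsub x ltac:(lra)). fold (tau x) in H3.
    assert (l * M <= l * W x) by nra.
    assert (- (M * (1 - l)) * (tau x * tau x) <= (l * W x - Q x) * (tau x * tau x))
      by (apply Rmult_le_compat_r; lra).
    lra.
  - unfold phi, tau. replace (t0 + slope * 0) with t0 by ring. lra.
Qed.

(** For l = -X with X large, the angle starts at PI + atan(-1/z) and the target
    is atan(1/T), with z and T of order X. A linear subsolution for the tangent
    from -1/z to 1/T has slope of order 1/X and satisfies X tau^2 = O(1/X),
    so the condition of phase_above_linear holds. *)
Lemma gap_neg_reaches_PI : exists l, l < 0 /\ PI <= gap l.
Proof.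
  assert (HM := M_pos).
  set (k := 2 / A1 + 2 / B1).
  assert (HA := Rdiv_lt_0_compat 2 A1 ltac:(lra) A1_pos).
  assert (HB := Rdiv_lt_0_compat 2 B1 ltac:(lra) B1_pos).
  assert (Hk : 0 < k) by (unfold k; lra).
  (* The terms 2 A2 / A1 and 2 B2 / B1 give z >= A1 X / 2 and T >= B1 X / 2,
     whence 1/z + 1/T <= k / X; the last term makes the slope condition hold. *)
  set (X := 1 + 2 * A2 / A1 + 2 * B2 / B1 + (k / L + 2 * M * (k * k)) / m).
  assert (H1 : 0 < 2 * A2 / A1) by (apply Rdiv_lt_0_compat; lra).
  assert (H2 : 0 < 2 * B2 / B1) by (apply Rdiv_lt_0_compat; lra).
  assert (H3 : 0 < k / L) by (apply Rdiv_lt_0_compat; lra).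
  assert (H4 : 0 < M * (k * k))
    by (apply Rmult_lt_0_compat; [|apply Rmult_lt_0_compat]; assumption).
  assert (H5 : 0 < (k / L + 2 * M * (k * k)) / m) by (apply Rdiv_lt_0_compat; lra).
  assert (HX : 1 <= X) by (unfold X; lra).
  exists (- X). split; [lra|].
  set (z := A1 * X - A2). set (T := B1 * X - B2).
  assert (Hz : A1 * X <= 2 * z).
  { unfold z. assert (A1 * (2 * A2 / A1) <= A1 * X) by (apply Rmult_le_compat_l; unfold X; lra).
    replace (A1 * (2 * A2 / A1)) with (2 * A2) in H by (field; lra). lra. }
  assert (HT : B1 * X <= 2 * T).
  { unfold T. assert (B1 * (2 * B2 / B1) <= B1 * X) by (apply Rmult_le_compat_l; unfold X; lra).
    replace (B1 * (2 * B2 / B1)) with (2 * B2) in H by (field; lra). lra. }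
  assert (HAX : 0 < A1 * X) by (apply Rmult_lt_0_compat; lra).
  assert (HBX : 0 < B1 * X) by (apply Rmult_lt_0_compat; lra).
  assert (Hz0 : 0 < z) by lra. assert (HT0 : 0 < T) by lra.
  assert (Iz := Rinv_0_lt_compat z Hz0). assert (IT := Rinv_0_lt_compat T HT0).
  assert (Hsum : / z + / T <= k / X).
  { assert (/ z <= 2 / A1 / X).
    { replace (2 / A1 / X) with (/ (A1 * X / 2)) by (field; lra).
      apply Rinv_le_contravar; lra. }
    assert (/ T <= 2 / B1 / X).
    { replace (2 / B1 / X) with (/ (B1 * X / 2)) by (field; lra).
      apply Rinv_le_contravar; lra. }
    unfold k, Rdiv in *. lra. }
  set (slope := (/ z + / T) / L).
  assert (HsL : slope * L = / z + / T) by (unfold slope; field; lra).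
  assert (Hslope : 0 <= slope) by (apply Rlt_le, Rdiv_lt_0_compat; lra).
  assert (H : PI + atan (- / z + slope * L) <= phase (- X) L).
  { apply phase_above_linear; [lra|exact Hslope| |].
    - intros x Hx.
      assert (0 <= slope * x <= slope * L)
        by (split; [apply Rmult_le_pos|apply Rmult_le_compat_l]; lra).
      assert (Hsq : (- / z + slope * x) * (- / z + slope * x) <= (k / X) * (k / X)).
      { apply Rsqr_le_abs_1. rewrite (Rabs_pos_eq (k / X)) by lra. apply Rabs_le. lra. }
      assert (H7 : M * (1 - - X) * ((- / z + slope * x) * (- / z + slope * x))
        <= M * (2 * X) * ((k / X) * (k / X))).
      { apply Rmult_le_compat; [|apply Rle_0_sqr| |exact Hsq].
        - apply Rmult_le_pos; lra.
        - apply Rmult_le_compat_l; lra. }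
      assert (H8 : slope <= k / X / L).
      { unfold slope. apply Rmult_le_compat_r; [|exact Hsum].
        apply Rlt_le, Rinv_0_lt_compat, L_pos. }
      assert (H9 : (k / L + 2 * M * (k * k)) / X <= m).
      { apply (Rmult_le_reg_r (X / m)). apply Rdiv_lt_0_compat; lra.
        replace ((k / L + 2 * M * (k * k)) / X * (X / m)) with
          ((k / L + 2 * M * (k * k)) / m) by (field; lra).
        replace (m * (X / m)) with X by (field; lra). unfold X at 1. lra. }
      replace ((k / L + 2 * M * (k * k)) / X) with
        (k / X / L + M * (2 * X) * (k / X * (k / X))) in H9 by (field; lra).
      lra.
    - rewrite phase_0. replace (A1 * - X + A2) with (- z) by (unfold z; ring).
      rewrite arccot_neg by exact Hz0. lra. }
  rewrite HsL in H. replace (- / z + (/ z + / T)) with (/ T) in H by ring.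
  unfold gap, target. replace (- (B1 * - X + B2)) with T by (unfold T; ring).
  rewrite arccot_inv_pos by exact HT0. lra.
Qed.

Lemma gap_value a b y : gap a <= y <= gap b ->
  exists l, Rmin a b <= l <= Rmax a b /\ gap l = y.
Proof.
  intros H. destruct (IVT_gen_consistent gap a b y gap_continuous) as [l Hl].
  - rewrite Rmin_left, Rmax_right by lra. exact H.
  - now exists l.
Qed.

Lemma gap_level_pos n : exists l, 0 < l /\ gap l = INR n * PI.
Proof.
  assert (HPI := PI_RGT_0). assert (Hn := pos_INR n). assert (H0 := gap_0_neg).
  destruct (gap_unbounded (INR n * PI)) as [b [Hb H]].
  assert (Hp : 0 <= INR n * PI) by (apply Rmult_le_pos; lra).
  destruct (gap_value 0 b (INR n * PI)) as [l [Hl E]]. lra.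
  rewrite Rmin_left in Hl by lra.
  exists l. split; [|exact E].
  destruct (Req_dec l 0) as [->|]; lra.
Qed.

Lemma gap_level_neg c : 0 <= c <= PI -> exists l, l < 0 /\ gap l = c.
Proof.
  intros Hc. assert (H0 := gap_0_neg).
  destruct gap_neg_reaches_PI as [b [Hb H]].
  destruct (gap_value 0 b c) as [l [Hl E]]. lra.
  rewrite Rmax_left in Hl by lra.
  exists l. split; [|exact E].
  destruct (Req_dec l 0) as [->|]; lra.
Qed.

(** The angle goes from ]0,PI[ to ]n PI,(n+1) PI[ and passes each of
    PI, ..., n PI exactly once, as it passes multiples of PI only upwards. *)
Lemma phase_zeros l n : gap l = INR n * PI ->
  exists zs, NoDup zs /\ length zs = n /\
    forall x, In x zs <-> 0 < x < L /\ sin (phase l x) = 0.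
Proof.
  intros Hn. assert (HPI := PI_RGT_0).
  assert (Ht : 0 < target l < PI) by apply arccot_bound.
  unfold gap in Hn.
  assert (H0 : 0 < phase l 0 < PI) by (rewrite phase_0; apply arccot_bound).
  assert (Hex : forall k : nat, exists x, (1 <= k <= n)%nat -> 0 < x < L /\ phase l x = INR k * PI).
  { intros k. destruct (le_dec 1 k) as [h1|]; [|exists 0; lia].
    destruct (le_dec k n) as [h2|]; [|exists 0; lia].
    apply le_INR in h1, h2. simpl INR in h1.
    assert (INR 1 * PI <= INR k * PI) by (apply Rmult_le_compat_r; simpl; lra).
    assert (INR k * PI <= INR n * PI) by (apply Rmult_le_compat_r; lra).
    simpl INR in H.
    destruct (IVT_gen_consistent (phase l) 0 L (INR k * PI) (phase_continuous l)) as [x [Hx E]].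
    { rewrite Rmin_left, Rmax_right by lra. lra. }
    rewrite Rmin_left, Rmax_right in Hx by lra.
    exists x. intros _. split; [|exact E].
    destruct (Req_dec x 0) as [->|]; [lra|]. destruct (Req_dec x L) as [->|]; lra. }
  set (z := fun k => proj1_sig (constructive_indefinite_description _ (Hex k))).
  assert (Hz : forall k, (1 <= k <= n)%nat -> 0 < z k < L /\ phase l (z k) = INR k * PI).
  { intros k. unfold z. destruct constructive_indefinite_description as [x Hx]. exact Hx. }
  exists (map z (seq 1 n)). split; [|split].
  - apply (NoDup_map_inv (phase l)). rewrite map_map.
    rewrite (map_ext_in _ (fun k => INR k * PI)).
    + apply Injective_map_NoDup; [|apply seq_NoDup].
      intros i j E. apply INR_eq, (Rmult_eq_reg_r PI); lra.
    + intros k Hk. apply in_seq in Hk. apply Hz. lia.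
  - now rewrite length_map, length_seq.
  - intros x. rewrite in_map_iff. split.
    + intros [k [<- Hk]]. apply in_seq in Hk. destruct (Hz k ltac:(lia)) as [H1 H2].
      split; [exact H1|]. rewrite H2, INR_IZR_INZ. apply sin_IZR_PI.
    + intros [Hx Hs]. apply sin_eq_0_0 in Hs as [k Hk].
      assert (Hpos := phase_pos l x ltac:(lra)).
      assert (Hk0 : (0 < k)%Z).
      { apply lt_IZR. apply (Rmult_lt_reg_r PI); lra. }
      assert (Hkn : (k < Z.of_nat n + 1)%Z).
      { apply lt_IZR. rewrite plus_IZR, <- INR_IZR_INZ.
        assert (H := phase_above l k x L ltac:(lra) ltac:(lra)).
        apply (Rmult_lt_reg_r PI); lra. }
      assert (Ek : INR (Z.to_nat k) = IZR k) by (rewrite INR_IZR_INZ; f_equal; lia).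
      exists (Z.to_nat k). split; [|apply in_seq; lia].
      destruct (Hz (Z.to_nat k) ltac:(lia)) as [H1 H2]. rewrite Ek in H2.
      destruct (Rtotal_order (z (Z.to_nat k)) x) as [h|[h|h]]; [|exact h|].
      * assert (H := phase_above l k _ _ h ltac:(lra)). lra.
      * assert (H := phase_above l k _ _ h ltac:(lra)). lra.
Qed.
(** On each side of 0 a level is crossed in one direction only, which gives
    both the uniqueness of the eigenvalue at each level and the order of the
    eigenvalues. *)
Lemma gap_spectrum : exists lam : label -> R,
  (forall l, sin (gap l) = 0 <-> exists k, l = lam k) /\
  lam lbl_m1 < lam lbl_m0 /\ lam lbl_m0 < 0 /\ 0 < lam (lbl 0) /\
  (forall n, lam (lbl n) < lam (lbl (S n))) /\
  is_lim_seq (fun n => lam (lbl n)) p_infty /\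
  (forall k, gap (lam k) = INR (label_abs k) * PI).
Proof.
  assert (HPI := PI_RGT_0).
  destruct (gap_level_neg 0 ltac:(lra)) as [l0 [Hl0 E0]].
  destruct (gap_level_neg PI ltac:(lra)) as [l1 [Hl1 E1]].
  set (pos := fun n => proj1_sig (constructive_indefinite_description _ (gap_level_pos n))).
  assert (Hpos : forall n, 0 < pos n /\ gap (pos n) = INR n * PI).
  { intros n. unfold pos. destruct constructive_indefinite_description as [x Hx]. exact Hx. }
  set (lam := fun k => match k with lbl_m1 => l1 | lbl_m0 => l0 | lbl n => pos n end).
  assert (Elam : forall k, gap (lam k) = INR (label_abs k) * PI).
  { intros [| |n]; simpl; [lra|lra|apply Hpos]. }
  exists lam. split; [|split; [|split; [|split; [|split; [|split]]]]].
  - intros l. split.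
    + intros Hs. apply sin_eq_0_0 in Hs as [k Hk].
      assert (Hgt := gap_gt_opp_PI l).
      assert (Hk0 : (-1 < k)%Z).
      { apply lt_IZR. apply (Rmult_lt_reg_r PI); lra. }
      destruct (Rtotal_order l 0) as [h|[h|h]].
      * assert (Hlt := gap_lt_2PI_of_nonpos l ltac:(lra)).
        assert (Hk1 : (k < 2)%Z).
        { apply lt_IZR. apply (Rmult_lt_reg_r PI); lra. }
        assert (k = 0 \/ k = 1)%Z as [-> | ->] by lia.
        -- exists lbl_m0. simpl.
           destruct (Rtotal_order l l0) as [g|[g|g]]; [|exact g|].
           ++ assert (H := gap_above_neg 0 l l0 Hl0 g ltac:(lra)). lra.
           ++ assert (H := gap_above_neg 0 l0 l h g ltac:(lra)). lra.
        -- exists lbl_m1. simpl.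
           destruct (Rtotal_order l l1) as [g|[g|g]]; [|exact g|].
           ++ assert (H := gap_above_neg 1 l l1 Hl1 g ltac:(lra)). lra.
           ++ assert (H := gap_above_neg 1 l1 l h g ltac:(lra)). lra.
      * subst l. assert (H := gap_0_neg). rewrite Hk in H.
        assert (k < 0)%Z; [|lia]. apply lt_IZR. apply (Rmult_lt_reg_r PI); lra.
      * exists (lbl (Z.to_nat k)). simpl.
        destruct (Hpos (Z.to_nat k)) as [H1 H2].
        assert (Ek : INR (Z.to_nat k) = IZR k) by (rewrite INR_IZR_INZ; f_equal; lia).
        rewrite Ek in H2.
        destruct (Rtotal_order l (pos (Z.to_nat k))) as [g|[g|g]]; [|exact g|].
        -- assert (H := gap_above k _ _ h g ltac:(lra)). lra.
        -- assert (H := gap_above k _ _ H1 g ltac:(lra)). lra.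
    + intros [k ->]. rewrite Elam, INR_IZR_INZ. apply sin_IZR_PI.
  - simpl. apply Rnot_le_lt. intros h.
    destruct (Req_dec l0 l1) as [e|]; [rewrite e in E0; lra|].
    assert (H0 := gap_above_neg 1 l0 l1 Hl1 ltac:(lra) ltac:(lra)). lra.
  - exact Hl0.
  - apply Hpos.
  - intros n. simpl. destruct (Hpos n) as [H1 H2]. destruct (Hpos (S n)) as [H3 H4].
    rewrite S_INR in H4. apply Rnot_le_lt. intros h.
    destruct (Req_dec (pos (S n)) (pos n)) as [e|]; [rewrite e in H4; lra|].
    assert (H0 := gap_above (Z.of_nat n) (pos (S n)) (pos n) H3 ltac:(lra)).
    rewrite <- INR_IZR_INZ in H0. specialize (H0 ltac:(lra)). lra.
  - assert (HML : 0 < M * L) by (apply Rmult_lt_0_compat; [apply M_pos|lra]).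
    apply (is_lim_seq_le_p_loc (fun n => INR n * (PI / (M * L)) - (PI / (M * L) + 1))).
    + exists 0%nat. intros n _. simpl. destruct (Hpos n) as [H1 H2].
      assert (H := gap_upper (pos n) ltac:(lra)). rewrite H2 in H.
      apply (Rmult_le_reg_r (M * L)); [exact HML|].
      replace ((INR n * (PI / (M * L)) - (PI / (M * L) + 1)) * (M * L)) with
        (INR n * PI - PI - M * L).
      * replace (pos n * (M * L)) with (M * (1 + pos n) * L - M * L) by ring. lra.
      * assert (H3 := M_pos). field. lra.
    + apply (is_lim_seq_minus _ _ p_infty (PI / (M * L) + 1)).
      * apply (is_lim_seq_mult _ _ p_infty (PI / (M * L))).
        apply is_lim_seq_INR. apply is_lim_seq_const.
        assert (H := Rdiv_lt_0_compat _ _ HPI HML).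
        apply (is_Rbar_mult_p_infty_pos (Finite (PI / (M * L)))). exact H.
      * apply is_lim_seq_const.
      * reflexivity.
  - exact Elam.
Qed.

(** * Uniqueness and reality *)
Lemma system_trivial l (U V : R -> R) :
  (forall x, continuous U x) -> (forall x, continuous V x) ->
  (forall x, 0 < x < L -> is_derive U x (P x * V x)) ->
  (forall x, 0 < x < L -> is_derive V x ((Q x - l * W x) * U x)) ->
  U 0 = 0 -> V 0 = 0 ->
  forall x, 0 <= x <= L -> U x = 0 /\ V x = 0.
Proof.
  intros CU CV DU DV U0 V0 x Hx.
  assert (H : U x * U x + V x * V x <= 0).
  { apply (gronwall_nonpos (fun t => U t * U t + V t * V t)
      (fun t => 2 * (U t * V t * (P t + Q t - l * W t))) 0 x (M * (2 + Rabs l))).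
    - lra.
    - intros t _. apply (continuous_plus (fun t => U t * U t) (fun t => V t * V t)).
      now apply (continuous_mult U U). now apply (continuous_mult V V).
    - intros t Ht. assert (H1 := DU t ltac:(lra)). assert (H2 := DV t ltac:(lra)).
      auto_derive. { repeat split; eexists; first [exact H1|exact H2]. }
      rewrite (is_derive_unique _ _ _ H1 : Derive (fun t : R => U t) t = _).
      rewrite (is_derive_unique _ _ _ H2 : Derive (fun t : R => V t) t = _). ring.
    - intros t _ _.
      assert (HB : Rabs (P t + Q t - l * W t) <= M * (2 + Rabs l)).
      { assert (H := P_bnd t). assert (H1 := Q_bnd t). assert (H2 := W_bnd t).
        assert (Hl := Rle_abs l). assert (Hl' := Rle_abs (- l)). rewrite Rabs_Ropp in Hl'.
        apply Rabs_le. split; nra. }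
      assert (HU : Rabs (2 * (U t * V t)) <= U t * U t + V t * V t).
      { assert (H1 := Rle_0_sqr (U t + V t)). assert (H2 := Rle_0_sqr (U t - V t)).
        unfold Rsqr in *. apply Rabs_le. lra. }
      replace (2 * (U t * V t * (P t + Q t - l * W t))) with
        ((P t + Q t - l * W t) * (2 * (U t * V t))) by ring.
      refine (Rle_trans _ _ _ (Rle_abs _) _). rewrite Rabs_mult.
      apply Rmult_le_compat; try apply Rabs_pos; assumption.
    - cbv beta. rewrite U0, V0. lra. }
  assert (H1 := Rle_0_sqr (U x)). assert (H2 := Rle_0_sqr (V x)). unfold Rsqr in *.
  split; nra.
Qed.

Lemma system_proportional l (U V : R -> R) :
  (forall x, continuous U x) -> (forall x, continuous V x) ->
  (forall x, 0 < x < L -> is_derive U x (P x * V x)) ->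
  (forall x, 0 < x < L -> is_derive V x ((Q x - l * W x) * U x)) ->
  V 0 = (A1 * l + A2) * U 0 ->
  exists c, forall x, 0 <= x <= L -> U x = c * sol l x /\ V x = c * sol_flux l x.
Proof.
  intros CU CV DU DV V0. assert (Hs := sol_0_pos l).
  exists (U 0 / sol l 0). set (c := U 0 / sol l 0).
  assert (Ec : c * sol l 0 = U 0) by (unfold c; field; lra).
  intros x Hx.
  assert (H : U x - c * sol l x = 0 /\ V x - c * sol_flux l x = 0); [|lra].
  apply (system_trivial l (fun t => U t - c * sol l t) (fun t => V t - c * sol_flux l t)).
  - intros t. apply (continuous_minus U (fun t => c * sol l t)). apply CU.
    apply (continuous_scal_r c (sol l)), sol_continuous.
  - intros t. apply (continuous_minus V (fun t => c * sol_flux l t)). apply CV.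
    apply (continuous_scal_r c (sol_flux l)), sol_flux_continuous.
  - intros t Ht. replace (P t * (V t - c * sol_flux l t)) with
      (P t * V t - c * (P t * sol_flux l t)) by ring.
    apply (is_derive_minus U (fun t => c * sol l t)). now apply DU.
    apply (is_derive_scal (sol l)), sol_derive.
  - intros t Ht. replace ((Q t - l * W t) * (U t - c * sol l t)) with
      ((Q t - l * W t) * U t - c * ((Q t - l * W t) * sol l t)) by ring.
    apply (is_derive_minus V (fun t => c * sol_flux l t)). now apply DV.
    apply (is_derive_scal (sol_flux l)), sol_flux_derive.
  - lra.
  - rewrite V0, sol_flux_0, <- Ec. ring.
  - exact Hx.
Qed.

(** Write f = U1 + i U2, v = V1 + i V2 and l = a + i b. The derivative of
    Re(v conj(f)) contains - a W |f|^2 and that of Im(v conj(f)) is - b W |f|^2. If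
    a + s b = 0, in particular if b <> 0 and s = - a / b, then W drops out of
    the derivative of K = Re(v conj(f)) + s Im(v conj(f)), which leaves
    P |v|^2 + Q |f|^2 >= 0. The boundary conditions give K(0) >= 0 >= K(L),
    so K vanishes identically, and with it f. *)
Lemma complex_system_trivial a b s (U1 U2 V1 V2 : R -> R) :
  a + s * b = 0 ->
  (forall x, continuous U1 x) -> (forall x, continuous U2 x) ->
  (forall x, continuous V1 x) -> (forall x, continuous V2 x) ->
  (forall x, 0 < x < L -> is_derive U1 x (P x * V1 x)) ->
  (forall x, 0 < x < L -> is_derive U2 x (P x * V2 x)) ->
  (forall x, 0 < x < L -> is_derive V1 x ((Q x - a * W x) * U1 x + b * W x * U2 x)) ->
  (forall x, 0 < x < L -> is_derive V2 x ((Q x - a * W x) * U2 x - b * W x * U1 x)) ->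
  V1 0 = (A1 * a + A2) * U1 0 - A1 * b * U2 0 ->
  V2 0 = (A1 * a + A2) * U2 0 + A1 * b * U1 0 ->
  V1 L = - (B1 * a + B2) * U1 L + B1 * b * U2 L ->
  V2 L = - (B1 * a + B2) * U2 L - B1 * b * U1 L ->
  forall x, 0 <= x <= L -> U1 x = 0 /\ U2 x = 0.
Proof.
  intros Hs CU1 CU2 CV1 CV2 DU1 DU2 DV1 DV2 B01 B02 BL1 BL2.
  set (N := fun x => U1 x * U1 x + U2 x * U2 x).
  assert (HN : forall x, N x = 0 -> U1 x = 0 /\ U2 x = 0).
  { intros x H. unfold N in H.
    assert (H1 := Rle_0_sqr (U1 x)). assert (H2 := Rle_0_sqr (U2 x)). unfold Rsqr in *.
    split; nra. }
  assert (HN0 : forall x, 0 <= N x).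
  { intros x. unfold N. assert (H1 := Rle_0_sqr (U1 x)). assert (H2 := Rle_0_sqr (U2 x)).
    unfold Rsqr in *. lra. }
  set (K := fun x => (V1 x * U1 x + V2 x * U2 x) + s * (V2 x * U1 x - V1 x * U2 x)).
  set (K' := fun x => P x * (V1 x * V1 x + V2 x * V2 x) + Q x * N x).
  assert (CK : forall x, continuous K x).
  { intros x. unfold K.
    apply (continuous_plus (fun x => V1 x * U1 x + V2 x * U2 x)
      (fun x => s * (V2 x * U1 x - V1 x * U2 x))).
    - apply (continuous_plus (fun x => V1 x * U1 x) (fun x => V2 x * U2 x)).
      now apply (continuous_mult V1 U1). now apply (continuous_mult V2 U2).
    - apply (continuous_scal_r s (fun x => V2 x * U1 x - V1 x * U2 x)).
      apply (continuous_minus (fun x => V2 x * U1 x) (fun x => V1 x * U2 x)).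
      now apply (continuous_mult V2 U1). now apply (continuous_mult V1 U2). }
  assert (DK : forall x, 0 < x < L -> is_derive K x (K' x)).
  { intros x Hx. unfold K.
    assert (H1 := DU1 x Hx). assert (H2 := DU2 x Hx).
    assert (H3 := DV1 x Hx). assert (H4 := DV2 x Hx).
    auto_derive. { repeat split; eexists; first [exact H1|exact H2|exact H3|exact H4]. }
    rewrite (is_derive_unique _ _ _ H1 : Derive (fun t : R => U1 t) x = _).
    rewrite (is_derive_unique _ _ _ H2 : Derive (fun t : R => U2 t) x = _).
    rewrite (is_derive_unique _ _ _ H3 : Derive (fun t : R => V1 t) x = _).
    rewrite (is_derive_unique _ _ _ H4 : Derive (fun t : R => V2 t) x = _).
    unfold K', N. replace a with (- (s * b)) by lra. ring. }
  assert (PK : forall x, Q x * N x <= K' x).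
  { intros x. unfold K'. assert (HP := P_bnd x).
    assert (H1 := Rle_0_sqr (V1 x)). assert (H2 := Rle_0_sqr (V2 x)). unfold Rsqr in *.
    assert (0 <= P x * (V1 x * V1 x + V2 x * V2 x)) by (apply Rmult_le_pos; lra). lra. }
  assert (QN : forall x, 0 <= Q x * N x).
  { intros x. assert (HQ := Q_bnd x). apply Rmult_le_pos; [lra|apply HN0]. }
  assert (MK : forall x y, 0 <= x -> x <= y -> y <= L -> K x <= K y).
  { intros x y Hx Hxy Hy. apply (le_of_derive_nonneg K K' x y Hxy).
    - intros; apply CK.
    - intros z Hz. apply DK. lra.
    - intros z _. exact (Rle_trans _ _ _ (QN z) (PK z)). }
  assert (K0 : K 0 = A2 * N 0).
  { unfold K, N. rewrite B01, B02. replace a with (- (s * b)) by lra. ring. }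
  assert (KL : K L = - (B2 * N L)).
  { unfold K, N. rewrite BL1, BL2. replace a with (- (s * b)) by lra. ring. }
  assert (HA := Rmult_le_pos A2 (N 0) ltac:(lra) (HN0 0)).
  assert (HB := Rmult_le_pos B2 (N L) ltac:(lra) (HN0 L)).
  assert (ZK : forall x, 0 <= x <= L -> K x = 0).
  { intros x Hx. assert (H1 := MK 0 x ltac:(lra) ltac:(lra) ltac:(lra)).
    assert (H2 := MK x L ltac:(lra) ltac:(lra) ltac:(lra)). lra. }
  intros x Hx. apply HN.
  destruct (Req_dec x 0) as [->|h0].
  { assert (H := ZK 0 Hx). rewrite K0 in H. apply Rmult_integral in H as [|]; lra. }
  destruct (Req_dec x L) as [->|hL].
  { assert (H := ZK L Hx). rewrite KL in H.
    assert (H1 : B2 * N L = 0) by lra. apply Rmult_integral in H1 as [|]; lra. }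
  assert (D0 : is_derive K x 0).
  { apply (is_derive_ext_loc (fun _ => 0)).
    - exists (mkposreal (Rmin x (L - x)) ltac:(apply Rmin_case; lra)).
      intros y Hy. symmetry. apply ZK.
      change (Rabs (y - x) < Rmin x (L - x)) in Hy. apply Rabs_def2 in Hy.
      assert (H1 := Rmin_l x (L - x)). assert (H2 := Rmin_r x (L - x)). lra.
    - apply (is_derive_const 0). }
  assert (E : K' x = 0).
  { rewrite <- (is_derive_unique _ _ _ (DK x ltac:(lra))).
    now apply is_derive_unique. }
  assert (H1 := PK x). assert (H2 := QN x). assert (HQ := Q_bnd x).
  assert (H3 : Q x * N x = 0) by lra. apply Rmult_integral in H3 as [|]; lra.
Qed.
(** * The boundary value problem *)
Context (p q r : R -> R) (alpha1 alpha2 beta1 beta2 : R).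
Context (P_p : forall x, 0 <= x <= L -> P x * p x = 1).
Context (Q_q : forall x, 0 <= x <= L -> Q x = q x).
Context (W_r : forall x, 0 <= x <= L -> W x = r x).
Context (A1_def : A1 = p 0 * alpha1) (A2_def : A2 = p 0 * alpha2).
Context (B1_def : B1 = - (p L * beta1)) (B2_def : B2 = p L * beta2).

(** The components are clamped to make them continuous on the whole line; in
    ]0,L[ this does not affect their derivatives. *)
Lemma solution_system a b f :
  is_solution L p q r alpha1 alpha2 beta1 beta2 (a, b) f ->
  exists U1 U2 V1 V2 : R -> R,
  (forall x, 0 <= x <= L -> f x = (U1 x, U2 x)) /\
  (forall x, continuous U1 x) /\ (forall x, continuous U2 x) /\
  (forall x, continuous V1 x) /\ (forall x, continuous V2 x) /\
  (forall x, 0 < x < L -> is_derive U1 x (P x * V1 x)) /\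
  (forall x, 0 < x < L -> is_derive U2 x (P x * V2 x)) /\
  (forall x, 0 < x < L -> is_derive V1 x ((Q x - a * W x) * U1 x + b * W x * U2 x)) /\
  (forall x, 0 < x < L -> is_derive V2 x ((Q x - a * W x) * U2 x - b * W x * U1 x)) /\
  V1 0 = (A1 * a + A2) * U1 0 - A1 * b * U2 0 /\
  V2 0 = (A1 * a + A2) * U2 0 + A1 * b * U1 0 /\
  V1 L = - (B1 * a + B2) * U1 L + B1 * b * U2 L /\
  V2 L = - (B1 * a + B2) * U2 L - B1 * b * U1 L.
Proof.
  intros [f' [g [[Df Cf'] [Dg [Eq [Bc0 BcL]]]]]].
  assert (Cf := continuous_on_of_derive_within _ _ _ Df).
  assert (CF := continuous_clamp L f (Rlt_le _ _ L_pos) Cf).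
  assert (CF' := continuous_clamp L f' (Rlt_le _ _ L_pos) Cf').
  assert (HP : forall x, P x <> 0) by (intros x; assert (H := P_bnd x); lra).
  assert (CI : forall x, continuous (fun t => / P t) x).
  { intros x. apply (continuous_comp P Rinv). apply P_cont.
    apply continuity_pt_filterlim, continuity_pt_inv.
    apply derivable_continuous_pt, derivable_pt_id. apply HP. }
  assert (C1 : forall (h : R -> C) x, continuous h x -> continuous (fun t => fst (h t)) x).
  { intros h x Hh. apply (continuous_comp h fst). exact Hh.
    destruct (h x). apply continuous_fst. }
  assert (C2 : forall (h : R -> C) x, continuous h x -> continuous (fun t => snd (h t)) x).
  { intros h x Hh. apply (continuous_comp h snd). exact Hh.
    destruct (h x). apply continuous_snd. }
  assert (Pp : forall x, 0 <= x <= L -> / P x = p x).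
  { intros x Hx. apply (Rmult_eq_reg_l (P x)); [|apply HP].
    rewrite (P_p x Hx). apply Rinv_r, HP. }
  assert (Near : forall x, 0 < x < L -> locally x (fun y => clamp L y = y)).
  { intros x Hx. generalize (locally_between L x Hx). apply filter_imp.
    intros y Hy. apply clamp_id. lra. }
  assert (DF : forall x, 0 < x < L ->
    is_derive (fun t => fst (f t)) x (fst (f' x)) /\
    is_derive (fun t => snd (f t)) x (snd (f' x))).
  { intros x Hx. apply is_derive_C_components.
    apply (is_derive_of_within (interval_cc 0 L)).
    - generalize (locally_between L x Hx). apply filter_imp.
      intros y Hy. unfold interval_cc. lra.
    - apply Df. unfold interval_cc. lra. }
  assert (DG : forall x, 0 < x < L ->
    is_derive (fun t => / P t * fst (f' t)) x (fst (g x)) /\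
    is_derive (fun t => / P t * snd (f' t)) x (snd (g x))).
  { intros x Hx. destruct (is_derive_C_components _ _ _ (Dg x Hx)) as [H1 H2].
    split; [revert H1|revert H2]; apply is_derive_ext_loc;
      generalize (locally_between L x Hx); apply filter_imp; intros y Hy;
      rewrite Pp by lra; simpl; ring. }
  assert (EG : forall x, 0 < x < L ->
    fst (g x) = (Q x - a * W x) * fst (f x) + b * W x * snd (f x) /\
    snd (g x) = (Q x - a * W x) * snd (f x) - b * W x * fst (f x)).
  { intros x Hx. assert (E := Eq x Hx).
    assert (E1 := f_equal fst E). assert (E2 := f_equal snd E).
    simpl in E1, E2. rewrite Q_q, W_r by lra. split; lra. }
  exists (fun x => fst (f (clamp L x))), (fun x => snd (f (clamp L x))),
    (fun x => / P x * fst (f' (clamp L x))), (fun x => / P x * snd (f' (clamp L x))).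
  split; [|split; [|split; [|split; [|split; [|split; [|split; [|split; [|split]]]]]]]].
  - intros x Hx. rewrite clamp_id by exact Hx. apply surjective_pairing.
  - intros x. apply (C1 (fun x => f (clamp L x))), CF.
  - intros x. apply (C2 (fun x => f (clamp L x))), CF.
  - intros x. apply (continuous_mult (fun t => / P t) (fun x => fst (f' (clamp L x)))).
    apply CI. apply (C1 (fun x => f' (clamp L x))), CF'.
  - intros x. apply (continuous_mult (fun t => / P t) (fun x => snd (f' (clamp L x)))).
    apply CI. apply (C2 (fun x => f' (clamp L x))), CF'.
  - intros x Hx. rewrite clamp_id by lra.
    replace (P x * (/ P x * fst (f' x))) with (fst (f' x)) by (field; apply HP).
    apply (is_derive_ext_loc (fun t => fst (f t))); [|apply DF, Hx].
    generalize (Near x Hx). apply filter_imp. intros y ->. reflexivity.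
  - intros x Hx. rewrite clamp_id by lra.
    replace (P x * (/ P x * snd (f' x))) with (snd (f' x)) by (field; apply HP).
    apply (is_derive_ext_loc (fun t => snd (f t))); [|apply DF, Hx].
    generalize (Near x Hx). apply filter_imp. intros y ->. reflexivity.
  - intros x Hx. rewrite clamp_id by lra. rewrite <- (proj1 (EG x Hx)).
    apply (is_derive_ext_loc (fun t => / P t * fst (f' t))); [|apply DG, Hx].
    generalize (Near x Hx). apply filter_imp. intros y ->. reflexivity.
  - intros x Hx. rewrite clamp_id by lra. rewrite <- (proj2 (EG x Hx)).
    apply (is_derive_ext_loc (fun t => / P t * snd (f' t))); [|apply DG, Hx].
    generalize (Near x Hx). apply filter_imp. intros y ->. reflexivity.
  - rewrite !clamp_id, !Pp, Bc0, BcL by lra. simpl.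
    rewrite A1_def, A2_def, B1_def, B2_def. repeat split; ring.
Qed.

Lemma real_eigenfunction l f :
  is_eigenfunction L p q r alpha1 alpha2 beta1 beta2 (RtoC l) f ->
  defect l = 0 /\ exists c1 c2, (c1 <> 0 \/ c2 <> 0) /\
    forall x, 0 <= x <= L -> f x = (c1 * sol l x, c2 * sol l x).
Proof.
  intros [Hsol [x0 [Hx0 Hne]]].
  destruct (solution_system l 0 f Hsol) as [U1 [U2 [V1 [V2
    [Ef [CU1 [CU2 [CV1 [CV2 [DU1 [DU2 [DV1 [DV2 [B01 [B02 [BL1 BL2]]]]]]]]]]]]]]]].
  destruct (system_proportional l U1 V1) as [c1 H1]; try assumption.
  { intros x Hx. replace ((Q x - l * W x) * U1 x) with
      ((Q x - l * W x) * U1 x + 0 * W x * U2 x) by ring. now apply DV1. }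
  { rewrite B01. ring. }
  destruct (system_proportional l U2 V2) as [c2 H2]; try assumption.
  { intros x Hx. replace ((Q x - l * W x) * U2 x) with
      ((Q x - l * W x) * U2 x - 0 * W x * U1 x) by ring. now apply DV2. }
  { rewrite B02. ring. }
  assert (Hc : c1 <> 0 \/ c2 <> 0).
  { destruct (Req_dec c1 0) as [e1|]; [|now left].
    destruct (Req_dec c2 0) as [e2|]; [|now right].
    exfalso. apply Hne. rewrite (Ef x0 Hx0), (proj1 (H1 x0 Hx0)), (proj1 (H2 x0 Hx0)), e1, e2.
    unfold RtoC. f_equal; ring. }
  split.
  - destruct (H1 L ltac:(lra)) as [E1 E2]. destruct (H2 L ltac:(lra)) as [E3 E4].
    assert (D1 : c1 * defect l = 0).
    { unfold defect. rewrite E1, E2, E3 in BL1. lra. }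
    assert (D2 : c2 * defect l = 0).
    { unfold defect. rewrite E1, E3, E4 in BL2. lra. }
    apply Rmult_integral in D1, D2. tauto.
  - exists c1, c2. split; [exact Hc|]. intros x Hx.
    now rewrite (Ef x Hx), (proj1 (H1 x Hx)), (proj1 (H2 x Hx)).
Qed.

Lemma eigenvalue_real mu :
  is_eigenvalue L p q r alpha1 alpha2 beta1 beta2 mu -> exists l, mu = RtoC l.
Proof.
  destruct mu as [a b]. intros [f [Hsol [x0 [Hx0 Hne]]]].
  destruct (Req_dec b 0) as [->|Hb]; [now exists a|]. exfalso.
  destruct (solution_system a b f Hsol) as [U1 [U2 [V1 [V2
    [Ef [CU1 [CU2 [CV1 [CV2 [DU1 [DU2 [DV1 [DV2 [B01 [B02 [BL1 BL2]]]]]]]]]]]]]]]].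
  apply Hne. rewrite (Ef x0 Hx0).
  destruct (complex_system_trivial a b (- a / b) U1 U2 V1 V2) with (x := x0)
    as [-> ->]; try assumption.
  - field. exact Hb.
  - reflexivity.
Qed.

Lemma sol_is_eigenfunction l : defect l = 0 ->
  is_eigenfunction L p q r alpha1 alpha2 beta1 beta2 (RtoC l) (fun x => RtoC (sol l x)).
Proof.
  intros HD. split.
  - exists (fun x => RtoC (P x * sol_flux l x)), (fun x => RtoC ((Q x - l * W x) * sol l x)).
    split; [split|split; [|split; [|split]]].
    + intros x Hx. apply is_derive_within_of_derive; [exact Hx|].
      apply is_derive_RtoC, sol_derive.
    + intros x _. apply (filterlim_filter_le_1 (F := locally x)). apply filter_le_within.
      apply (continuous_comp (V := R_UniformSpace) (W := C_R_NormedModule)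
        (fun x => P x * sol_flux l x) RtoC).
      * apply (continuous_mult P (sol_flux l)). apply P_cont. apply sol_flux_continuous.
      * apply (filterdiff_continuous (U := R_NormedModule) (V := C_R_NormedModule) RtoC).
        exists RtoC. apply filterdiff_linear, is_linear_RtoC.
    + intros x Hx. apply (is_derive_ext_loc (V := C_R_NormedModule) (fun t => RtoC (sol_flux l t))).
      * generalize (locally_between L x Hx). apply filter_imp. intros y Hy.
        rewrite <- RtoC_mult. f_equal.
        replace (p y * (P y * sol_flux l y)) with (P y * p y * sol_flux l y) by ring.
        rewrite P_p by lra. ring.
      * apply is_derive_RtoC, sol_flux_derive.
    + intros x Hx. unfold interval_oo in Hx. rewrite <- Q_q, <- W_r by lra.
      apply injective_projections; simpl; ring.
    + rewrite <- !RtoC_mult, <- RtoC_plus, <- RtoC_mult. f_equal.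
      rewrite sol_flux_0, A1_def, A2_def.
      transitivity (P 0 * p 0 * ((alpha1 * l + alpha2) * sol l 0)); [ring|].
      rewrite P_p by lra. ring.
    + rewrite <- !RtoC_mult, <- RtoC_minus, <- RtoC_mult. f_equal.
      unfold defect in HD.
      replace (sol_flux l L) with (- (B1 * l + B2) * sol l L) by lra.
      rewrite B1_def, B2_def.
      transitivity (P L * p L * ((beta1 * l - beta2) * sol l L)); [ring|].
      rewrite P_p by lra. ring.
  - exists 0. split; [unfold interval_cc; lra|].
    intros E. apply RtoC_inj in E. assert (H := sol_0_pos l). lra.
Qed.

Lemma eigenvalue_iff mu :
  is_eigenvalue L p q r alpha1 alpha2 beta1 beta2 mu <->
  exists l, mu = RtoC l /\ sin (gap l) = 0.
Proof.
  split.
  - intros H. destruct (eigenvalue_real mu H) as [l ->]. exists l. split; [reflexivity|].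
    destruct H as [f Hf]. apply defect_zero_iff. now apply (real_eigenfunction l f).
  - intros [l [-> H]]. eexists. now apply sol_is_eigenfunction, defect_zero_iff.
Qed.

Lemma eigenfunction_zeros l n f :
  gap l = INR n * PI ->
  is_eigenfunction L p q r alpha1 alpha2 beta1 beta2 (RtoC l) f ->
  has_exactly_zeros (interval_oo 0 L) f n.
Proof.
  intros Hn Hf. destruct (real_eigenfunction l f Hf) as [_ [c1 [c2 [Hc Ef]]]].
  destruct (phase_zeros l n Hn) as [zs [H1 [H2 H3]]].
  exists zs. split; [exact H1|split; [exact H2|]].
  intros x. rewrite H3. unfold interval_oo.
  split; intros [Hx E]; (split; [exact Hx|]); rewrite Ef in * by lra.
  - unfold sol. rewrite E. unfold RtoC. f_equal; ring.
  - injection E as E1 E2. assert (He := exp_pos (log_amplitude l x)).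
    assert (Hs : sol l x = 0) by (apply Rmult_integral in E1, E2; tauto).
    unfold sol in Hs. apply Rmult_integral in Hs as [|]; lra.
Qed.

Lemma spectrum_of_system :
  exists lam : label -> R,
    (forall mu : C, is_eigenvalue L p q r alpha1 alpha2 beta1 beta2 mu <->
       exists k : label, mu = RtoC (lam k)) /\
    lam lbl_m1 < lam lbl_m0 /\ lam lbl_m0 < 0 /\ 0 < lam (lbl 0) /\
    (forall n, lam (lbl n) < lam (lbl (S n))) /\
    is_lim_seq (fun n => lam (lbl n)) p_infty /\
    (forall (k : label) (f : R -> C),
       is_eigenfunction L p q r alpha1 alpha2 beta1 beta2 (RtoC (lam k)) f ->
       has_exactly_zeros (interval_oo 0 L) f (label_abs k)).
Proof.
  destruct gap_spectrum as [lam [H1 [H2 [H3 [H4 [H5 [H6 H7]]]]]]].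
  exists lam. split; [|do 5 (split; [assumption|]); intros k f; apply eigenfunction_zeros, H7].
  intros mu. rewrite eigenvalue_iff. split.
  - intros [l [-> H]]. apply H1 in H as [k ->]. now exists k.
  - intros [k ->]. exists (lam k). split; [reflexivity|]. apply H1. now exists k.
Qed.

End SturmLiouville.

Theorem theorem1p1 (L : R) (p q r : R -> R) (alpha1 alpha2 beta1 beta2 : R)
    (L_pos : 0 < L)
    (pqr_regular : regular_coefficients L p q r)
    (p_pos : positive_on (interval_cc 0 L) p)
    (q_pos : positive_on (interval_cc 0 L) q)
    (r_pos : positive_on (interval_cc 0 L) r)
    (alpha1_pos : 0 < alpha1) (beta1_neg : beta1 < 0)
    (alpha2_pos : 0 < alpha2) (beta2_pos : 0 < beta2) :
  exists lam : label -> R,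
    (forall mu : C,
       is_eigenvalue L p q r alpha1 alpha2 beta1 beta2 mu <->
       exists l : label, mu = RtoC (lam l)) /\
    lam lbl_m1 < lam lbl_m0 /\
    lam lbl_m0 < 0 /\
    0 < lam (lbl 0%nat) /\
    (forall n : nat, lam (lbl n) < lam (lbl (S n))) /\
    is_lim_seq (fun n : nat => lam (lbl n)) p_infty /\
    (forall (l : label) (f : R -> C),
       is_eigenfunction L p q r alpha1 alpha2 beta1 beta2 (RtoC (lam l)) f ->
       has_exactly_zeros (interval_oo 0 L) f (label_abs l)).
Proof.
  destruct pqr_regular as [[p' [Dp _]] [Cq Cr]].
  assert (HL := Rlt_le _ _ L_pos).
  assert (Cp : continuous_on (interval_cc 0 L) p)
    by exact (continuous_on_of_derive_within _ _ _ Dp).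
  destruct (positive_bounds L p HL Cp p_pos) as [mp [Mp [Hmp Bp]]].
  destruct (positive_bounds L q HL Cq q_pos) as [mq [Mq [Hmq Bq]]].
  destruct (positive_bounds L r HL Cr r_pos) as [mr [Mr [Hmr Br]]].
  assert (HMp : 0 < Mp) by (assert (H := Bp 0); lra).
  assert (p0 : 0 < p 0) by (apply p_pos; unfold interval_cc; lra).
  assert (pL : 0 < p L) by (apply p_pos; unfold interval_cc; lra).
  assert (iMp := Rinv_0_lt_compat _ HMp).
  apply (spectrum_of_system (fun x => / p (clamp L x)) (fun x => q (clamp L x))
    (fun x => r (clamp L x))
    (Rmin (/ Mp) (Rmin mq mr)) (Rmax (/ mp) (Rmax Mq Mr))) with
    (A1 := p 0 * alpha1) (A2 := p 0 * alpha2) (B1 := - (p L * beta1)) (B2 := p L * beta2).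
  - repeat apply Rmin_case; assumption.
  - intros x. apply (continuous_comp (fun x => p (clamp L x)) Rinv).
    now apply continuous_clamp.
    apply continuity_pt_filterlim, continuity_pt_inv.
    apply derivable_continuous_pt, derivable_pt_id. assert (H := Bp x). lra.
  - intros x. assert (H := Bp x). split.
    + refine (Rle_trans _ _ _ (Rmin_l _ _) _). apply Rinv_le_contravar; lra.
    + refine (Rle_trans _ _ _ _ (Rmax_l _ _)). apply Rinv_le_contravar; lra.
  - now apply continuous_clamp.
  - intros x. destruct (Bq x) as [H1 H2]. split.
    + refine (Rle_trans _ _ _ (Rmin_r _ _) (Rle_trans _ _ _ (Rmin_l _ _) H1)).
    + refine (Rle_trans _ _ _ (Rle_trans _ _ _ H2 (Rmax_l _ _)) (Rmax_r _ _)).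
  - now apply continuous_clamp.
  - intros x. destruct (Br x) as [H1 H2]. split.
    + refine (Rle_trans _ _ _ (Rmin_r _ _) (Rle_trans _ _ _ (Rmin_r _ _) H1)).
    + refine (Rle_trans _ _ _ (Rle_trans _ _ _ H2 (Rmax_r _ _)) (Rmax_r _ _)).
  - exact L_pos.
  - now apply Rmult_lt_0_compat.
  - now apply Rmult_lt_0_compat.
  - assert (0 < p L * - beta1) by (apply Rmult_lt_0_compat; lra). lra.
  - now apply Rmult_lt_0_compat.
  - intros x Hx. rewrite clamp_id by exact Hx. apply Rinv_l.
    apply Rgt_not_eq, p_pos. exact Hx.
  - intros x Hx. now rewrite clamp_id.
  - intros x Hx. now rewrite clamp_id.
  - reflexivity.
  - reflexivity.
  - reflexivity.
  - reflexivity.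
Qed.
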